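(* Let $\varepsilon>0$. There is a constant $C>0$ depending only on $\varepsilon$ such that for all real $Q,N\ge1$ and every sequence $(a_n)$ of complex numbers, with $$T:=\sum_{q\le Q}\ \sum_{\substack{a=1\\ \gcd(a,q)=1}}^{q^2}\left|S\!\left(\frac{a}{q^2}\right)\right|^2,\qquad S(\alpha)=\sum_{n\le N}a_ne(n\alpha),\quad Z=\sum_{n\le N}|a_n|^2,$$ ($e(x)=e^{2\pi i x}$, $q$ running over positive integers) we have $$T\le\begin{cases} C\,Q^{3/5+\varepsilon}NZ, & \text{if } Q\le N^{5/12},\\ C\,Q^{3+\varepsilon}Z, & \text{if } Q>N^{5/12}.\end{cases}$$ *)

(* Defs.v *)
From HB Require Import structures.
From mathcomp Require Import all_boot all_order all_algebra.
From mathcomp Require Import all_classical all_reals all_analysis.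
From mathcomp.real_closed Require Import complex.

Set Implicit Arguments.
Unset Strict Implicit.
Unset Printing Implicit Defensive.

Import Order.TTheory GRing.Theory Num.Theory.

Local Open Scope ring_scope.

(* R[i] has no complex exponential, so
   e(x) = exp(2 pi i x) is given by Euler's formula. *)
Definition e (R : realType) (x : R) : R[i] :=
  Complex (cos (2 * pi * x)) (sin (2 * pi * x)).

(* The bound N is real and n runs over the positive integers n <= N;
   only the values c n with 1 <= n <= N matter. *)
Definition expsum (R : realType) (c : nat -> R[i]) (N alpha : R) : R[i] :=
  \sum_(1 <= n < (Num.truncn N).+1) c n * e (n%:R * alpha).

(* Normc.normc is the R-valued modulus; `|z| on R[i] is R[i]-valued. *)
Definition sqnorm (R : realType) (c : nat -> R[i]) (N : R) : R :=
  \sum_(1 <= n < (Num.truncn N).+1) Normc.normc (c n) ^+ 2.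

Definition square_sieve_sum (R : realType) (c : nat -> R[i]) (Q N : R) : R :=
  \sum_(1 <= q < (Num.truncn Q).+1)
    \sum_(1 <= a < (q ^ 2).+1 | coprime a q)
      Normc.normc (expsum c N (a%:R / (q ^ 2)%:R)) ^+ 2.

(* Main.v *)
Require Import Defs.
From HB Require Import structures.
From mathcomp Require Import all_boot all_order all_algebra.
From mathcomp Require Import all_classical all_reals all_analysis.
From mathcomp.real_closed Require Import complex.
From mathcomp Require Import zify ring lra.
Import Order.TTheory GRing.Theory Num.Theory.
Local Open Scope ring_scope.
Import Normc.

Set Implicit Arguments.
Unset Strict Implicit.
Unset Printing Implicit Defensive.

(** Extending (a_n) by zero up to N = Q^(12/5) reduces the range Q > N^(5/12) to the
range Q <= N^(5/12).  There the large sieve (duality) bounds T by K N Z, up to a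
constant, where K is the maximal number of reduced fractions a/q^2, q <= Q, in an arc
of length about 1/N <= Q^(-12/5).  Write Q = y^5; the claim becomes
K << Q^eps y^3 for arcs of length << y^(-12) around any beta.  Take a Dirichlet
approximation |r beta - b| <= y^(-8) with r << y^8.  If r >= y^4, the condition
||q^2 beta|| << y^(-2) is detected by a Fejer kernel with about y^2 frequencies, and
Weyl differencing suffices.  If r < y^4, then m = a r - b q^2 is a small integer with
q^2 = -m/b mod r, and for fixed m the q are confined to a short interval and to few
residue classes mod r, except when a large square divides 4m, which is rare.
All losses are divisor bounds or logarithms, hence O(Q^eps). *)

(** * Exponentials *)

(** The substitution Q = y^5 makes the critical exponents integral: the critical N is y^12 and the
    target factor Q^(3/5) is y^3. The cut at r = y^4 is the place where both methods still reach
    y^3. Weyl differencing turns the second moment of about y^2 quadratic sums of length y^5 into a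
    sum over about y^7 linear frequencies, of size y^12 / r + y^7 + r up to logarithms. This is
    O(y^8) for y^4 <= r << y^8, so the first moment is O(y^5), and division by the y^2 frequencies
    leaves y^3. For r < y^4 there are only about Q^2 / y^8 = y^2 values of m, and the short
    intervals contribute Q^3 / y^12 = y^3; here r < y^4 keeps the blur r / y^12 caused by the arc
    below y^(-8). Losses are collected in a single number E that bounds divisor counts and harmonic
    sums up to 8 y^8; epsilon enters only once the counting is complete. *)

Lemma normc_ge0 (R : rcfType) (z : R[i]) : 0 <= normc z.
Proof. by case: z => a b; exact: sqrtr_ge0. Qed.

Lemma normc_real (R : rcfType) (x : R) : 0 <= x -> normc x%:C%C = x.
Proof. by move=> x0; rewrite /= expr0n addr0 sqrtr_sqr ger0_norm. Qed.

Lemma normc_natr (R : rcfType) (n : nat) : normc (n%:R : R[i]) = n%:R.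
Proof. by rewrite -(rmorph_nat (real_complex R)) normc_real. Qed.

Lemma normc_conj (R : rcfType) (z : R[i]) : normc z^*%C = normc z.
Proof. by case: z => a b /=; rewrite sqrrN. Qed.

Lemma normc_sum (R : rcfType) (I : Type) (s : seq I) (P : pred I)
    (F : I -> R[i]) :
  normc (\sum_(i <- s | P i) F i) <= \sum_(i <- s | P i) normc (F i).
Proof.
elim/big_rec2: _ => [|i x y _ le_yx]; first by rewrite normc0.
by apply: le_trans (le_normcD _ _) _; rewrite lerD2l.
Qed.

Lemma sqr_normcE (R : rcfType) (z : R[i]) :
  (normc z ^+ 2)%:C%C = z * z^*%C.
Proof. by rewrite -sqr_normc rmorphXn. Qed.

Lemma Re_le_normc (R : rcfType) (z : R[i]) : complex.Re z <= normc z.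
Proof.
case: z => a b /=; apply: le_trans (ler_norm _) _.
by rewrite -sqrtr_sqr ler_wsqrtr // lerDl sqr_ge0.
Qed.

Lemma eD (R : realType) (x y : R) : e (x + y) = e x * e y.
Proof.
by rewrite /e mulrDr cosD sinD; congr Complex; rewrite addrC // [RHS]addrC.
Qed.

Lemma e0 (R : realType) : e (0 : R) = 1.
Proof. by rewrite /e mulr0 cos0 sin0. Qed.

Lemma e_conj (R : realType) (x : R) : (e x)^*%C = e (- x).
Proof. by rewrite /e mulrN cosN sinN. Qed.

Lemma normc_e (R : realType) (x : R) : normc (e x) = 1.
Proof. by rewrite /= cos2Dsin2 sqrtr1. Qed.

Lemma eMn (R : realType) (x : R) (n : nat) : e (n%:R * x) = e x ^+ n.
Proof.
elim: n => [|n IHn]; first by rewrite mul0r e0.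
by rewrite exprS -IHn -eD -natr1 mulrDl mul1r addrC.
Qed.

Lemma eN (R : realType) (x : R) : e (- x) = (e x)^-1.
Proof.
have nz : e x != 0.
  by apply/negP => /eqP /(congr1 (@normc R)); rewrite normc_e normc0 => /eqP;
    rewrite oner_eq0.
by apply: (mulIf nz); rewrite -eD addNr e0 mulVf.
Qed.

Lemma eDint (R : realType) (x : R) (k : int) : e (x + k%:~R) = e x.
Proof.
have e1 : e (1 : R) = 1.
  by rewrite /e mulr1 mulr_natl cos2pi sin2pi.
have en n : e (n%:R : R) = 1 by rewrite -[n%:R]mulr1 eMn e1 expr1n.
rewrite eD; case: k => n; first by rewrite en mulr1.
by rewrite NegzE mulrNz eN en invr1 mulr1.
Qed.

(** Its absolute value is the distance from x to the nearest integer. The sign is kept so that an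
    arc of the circle can be given as an interval of values. *)
Definition centered_frac (R : realType) (x : R) : R :=
  x - (Num.floor (x + 1 / 2))%:~R.

Lemma centered_frac_itv (R : realType) (x : R) :
  - (1 / 2) <= centered_frac x < 1 / 2.
Proof.
rewrite /centered_frac; have /andP[] := floor_itv (x + 1 / 2).
by rewrite intrD; move: (_%:~R) => k; lra.
Qed.

Lemma e_centered_frac (R : realType) (x : R) : e (centered_frac x) = e x.
Proof. by rewrite /centered_frac -mulrNz eDint. Qed.

Lemma e_sub1_sqr (R : realType) (x : R) :
  normc (e x - 1) ^+ 2 = 2 - 2 * cos (2 * pi * x).
Proof.
rewrite /= subr0 sqr_sqrtr ?addr_ge0 ?sqr_ge0 //.
by have := cos2Dsin2 (2 * pi * x); lra.
Qed.

(* The claim is clear for x in [1/4, 1/2], where cos(2 pi x) <= 0; smaller x are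
   doubled, since |e(2x) - 1| <= 2|e(x) - 1|. *)
Lemma e_sub1_ge_pos (R : realType) (x : R) :
  0 <= x <= 1 / 2 -> 2 * x <= normc (e x - 1).
Proof.
have big (y : R) : 1 / 4 <= y <= 1 / 2 -> 2 * y <= normc (e y - 1).
  move=> /andP[y1 y2].
  suff: 1 <= normc (e y - 1) by lra.
  rewrite -(@ler_pXn2r _ 2) ?nnegrE ?normc_ge0 // expr1n e_sub1_sqr.
  suff: cos (2 * pi * y) <= 0 by lra.
  have -> : 2 * pi * y = (2 * pi * y - pi / 2) + pi / 2 by lra.
  rewrite cosDpihalf oppr_le0; apply: sin_ge0_pi.
  have p0 := @pi_gt0 R.
  have := mulr_ge0 (ltW p0) (_ : 0 <= y - 1 / 4).
  have := mulr_ge0 (ltW p0) (_ : 0 <= 1 / 2 - y).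
  move: (pi) p0 => p p0 /(_ ltac:(lra)) h1 /(_ ltac:(lra)) h2.
  by apply/andP; split; nra.
have step (y : R) : 2 * (2 * y) <= normc (e (2 * y) - 1) -> 2 * y <= normc (e y - 1).
  have -> : e (2 * y) - 1 = (e y - 1) * (e y + 1).
    by rewrite eMn expr2 mulrDr mulrBl mul1r mulr1; ring.
  rewrite normcM.
  have := le_normcD (e y) 1; rewrite normc_e normc1.
  have := normc_ge0 (e y - 1); nra.
have main n : forall y : R, 1 / 4 / 2 ^+ n <= y <= 1 / 2 -> 2 * y <= normc (e y - 1).
  elim: n => [|n IHn] y; first by rewrite expr0 divr1; exact: big.
  move=> /andP[y1 y2]; have [y4|y4] := leP (1 / 4) y; first by apply: big; lra.
  apply: step; apply: IHn; apply/andP; split; last by lra.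
  by move: y1; rewrite exprS invfM; move: ((2 ^+ n)^-1) => t; lra.
move=> /andP[x0 x2]; have [->|xn0] := eqVneq x 0.
  by rewrite mulr0 normc_ge0.
have {x0 xn0}x0 : 0 < x by rewrite lt0r xn0.
apply: (main (Num.truncn x^-1)); rewrite x2 andbT.
have := truncnS_gt x^-1; set n := Num.truncn _ => lt_n.
have : (n.+1%:R : R) <= 2 ^+ n by rewrite -natrX ler_nat ltn_expl.
have p0 : 0 < (2 : R) ^+ n by rewrite exprn_gt0.
rewrite ler_pdivrMr //.
have : 1 = x * x^-1 by rewrite divff // gt_eqF.
move: (x^-1) lt_n p0 => t; move: (2 ^+ n) (n.+1%:R) => u v; nra.
Qed.

Lemma e_sub1_ge (R : realType) (x : R) :
  2 * `|centered_frac x| <= normc (e x - 1).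
Proof.
rewrite -(e_centered_frac x).
have /andP[] := centered_frac_itv x; move: (centered_frac x) => t t1 t2.
have [t0|t0] := ger0P t; first by apply: e_sub1_ge_pos; lra.
rewrite -normc_conj rmorphB rmorph1 [X in normc (X - _)]e_conj.
by apply: e_sub1_ge_pos; lra.
Qed.

Lemma geometric_e_le_size (R : realType) (x : R) (a b : nat) :
  normc (\sum_(a <= n < b) e (n%:R * x)) <= (b - a)%:R.
Proof.
apply: le_trans (normc_sum _ _ _) _.
by under eq_bigr do rewrite normc_e; rewrite sumr_const_nat.
Qed.

(** Telescoping against e(x) - 1, whose modulus is at least twice the distance from x to the nearest
    integer. The product form stays meaningful for integral x. *)
Lemma geometric_e_le_frac (R : realType) (x : R) (a b : nat) :
  normc (\sum_(a <= n < b) e (n%:R * x)) * `|centered_frac x| <= 1.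
Proof.
set S := \sum_(_ <= _ < _) _.
have [leab|ltba] := leqP a b; last first.
  by rewrite /S big_geq ?(ltnW ltba) // normc0 mul0r.
have tel : S * (e x - 1) = e (b%:R * x) - e (a%:R * x).
  rewrite /S mulr_suml -(telescope_sumr (fun n => e (n%:R * x))) //.
  apply: eq_bigr => n _.
  by rewrite mulrBr mulr1 -eD -natr1 mulrDl mul1r.
have le2 : normc (S * (e x - 1)) <= 2.
  rewrite tel; apply: le_trans (le_normcD _ _) _.
  by rewrite normcN !normc_e.
rewrite normcM in le2.
have := ler_wpM2l (normc_ge0 S) (e_sub1_ge x); rewrite mulrCA.
by move: (normc S * `|_|) le2 => u; lra.
Qed.

(** * The large sieve *)

(** Points are sorted by their distance to the nearest integer, in steps of eta. One bucket consists
    of two arcs, one on each side of 0, whence the factor 2 K; J steps exhaust the largest possible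
    distance 1/2. The large sieve takes f decaying like 1/j^2, Weyl differencing like 1/j. *)
Lemma bucket_sum (R : realType) (I : eqType) (s : seq I) (x F : I -> R)
    (f : nat -> R) (eta : R) (J K : nat) :
    0 < eta -> 1 / 2 < J%:R * eta ->
    (forall t, (count (fun i => (t <= centered_frac (x i) <= t + eta)%R) s <= K)%N) ->
    (forall j, 0 <= f j) ->
    (forall i j, i \in s -> j%:R * eta <= `|centered_frac (x i)| -> F i <= f j) ->
  \sum_(i <- s) F i <= 2 * K%:R * \sum_(0 <= j < J) f j.
Proof.
move=> eta0 etaJ cntK f0 Ff.
pose P i (j : nat) := (j%:R * eta <= `|centered_frac (x i)| <= j%:R * eta + eta).
apply: (@le_trans _ _ (\sum_(i <- s) \sum_(0 <= j < J) (if P i j then f j else 0))).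
  rewrite big_seq [leRHS]big_seq; apply: ler_sum => i si.
  set u := `|centered_frac (x i)|.
  pose j := Num.truncn (u / eta).
  have u0 : 0 <= u / eta by rewrite divr_ge0 ?(ltW eta0) // normr_ge0.
  have /andP[j1 j2] := truncn_itv u0; rewrite -/j in j1 j2.
  have {}j1 : j%:R * eta <= u by rewrite -ler_pdivlMr.
  have {}j2 : u < j%:R * eta + eta.
    by move: j2; rewrite ltr_pdivrMr // -natr1 mulrDl mul1r.
  have u2 : u <= 1 / 2.
    have /andP[h1 h2] := centered_frac_itv (x i).
    by rewrite /u ler_norml h1 ltW.
  have jJ : (j < J)%N.
    rewrite -(ltr_nat R) -(ltr_pM2r eta0); apply: le_lt_trans j1 _.
    exact: le_lt_trans u2 _.
  rewrite big_mkord (bigD1 (Ordinal jJ)) //= /P j1 (ltW j2) /=.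
  apply: le_trans (Ff _ _ si j1) _; rewrite lerDl.
  by apply: sumr_ge0 => k _; case: ifP.
rewrite exchange_big mulr_sumr; apply: ler_sum => j _.
rewrite -big_mkcond /= big_const_seq iter_addr_0 -[leLHS]mulr_natl.
apply: ler_wpM2r => //; rewrite -natrM ler_nat mul2n -addnn.
have h1 := cntK (j%:R * eta); have h2 := cntK (- (j%:R * eta) - eta).
apply: leq_trans (leq_add h1 h2); rewrite -count_predUI.
apply: leq_trans (leq_addr _ _); apply: sub_count => i /=.
rewrite /P; case: ger0P => _ /andP[k1 k2]; first by rewrite k1 k2.
by apply/orP; right; apply/andP; split; lra.
Qed.

(** The Fejer kernel as the square of a Dirichlet kernel. It serves twice: for the Gram matrix of
    the large sieve, and to detect the q with q^2 beta near an integer. *)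
Lemma sum_e_diff (R : realType) (m n : nat) (t : R) :
  \sum_(m <= i < n) \sum_(m <= j < n) e ((i%:R - j%:R) * t) =
  (normc (\sum_(m <= i < n) e (i%:R * t)) ^+ 2)%:C%C.
Proof.
rewrite sqr_normcE rmorph_sum mulr_suml; apply: eq_bigr => i _.
rewrite mulr_sumr; apply: eq_bigr => j _.
by rewrite mulrBl eD -e_conj.
Qed.

(* Duality: put b_i = conj (S (x_i)) and T = sum |S (x_i)|^2, so that
   T = sum_n c_n g(n) with g(n) = sum_i b_i e(n x_i).  Each n in [1, M] is a
   difference of two elements of [0, 2M) in at least M ways, and summing |g|^2 over
   all such differences yields the Gram matrix |D(x_i - x_j)|^2. *)
Lemma large_sieve_duality (R : realType) (I : eqType) (s : seq I) (x : I -> R)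
    (c : nat -> R[i]) (M : nat) (B : R) : (0 < M)%N -> 0 < B ->
    (forall i, i \in s ->
      \sum_(j <- s) normc (\sum_(0 <= n < M + M) e (n%:R * (x i - x j))) ^+ 2
        <= B * M%:R) ->
  \sum_(i <- s) normc (\sum_(1 <= n < M.+1) c n * e (n%:R * x i)) ^+ 2
    <= B * \sum_(1 <= n < M.+1) normc (c n) ^+ 2.
Proof.
move=> M0 B0 bound.
pose S i := \sum_(1 <= n < M.+1) c n * e (n%:R * x i).
pose b i := (S i)^*%C.
pose g (k : R) := \sum_(i <- s) b i * e (k * x i).
pose D i j := normc (\sum_(0 <= n < M + M) e (n%:R * (x i - x j))) ^+ 2.
set T := (X in X <= _); set Z := \sum_(_ <= _ < _) _.
pose G := \sum_(1 <= n < M.+1) normc (g n%:R) ^+ 2.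
have T0 : 0 <= T by apply: sumr_ge0 => i _; rewrite exprn_ge0 ?normc_ge0.
have M0' : 0 < M%:R :> R by rewrite ltr0n.
have TE : T%:C%C = \sum_(1 <= n < M.+1) c n * g n%:R.
  rewrite /T rmorph_sum (eq_bigr (fun i => S i * b i)); last first.
    by move=> i _; exact: sqr_normcE.
  under eq_bigr do rewrite /S mulr_suml.
  rewrite exchange_big; apply: eq_bigr => n _.
  rewrite mulr_sumr; apply: eq_bigr => i _.
  by rewrite -mulrA; congr (_ * _); rewrite mulrC.
(* AM-GM weighted by B: once G <= B T is known, the term G / B is absorbed by one of the two copies
   of T. *)
have T_le : 2 * T <= B * Z + G / B.
  rewrite -{1}(normc_real T0) TE.
  apply: le_trans (ler_wpM2l _ (normc_sum _ _ _)) _ => //.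
  rewrite /Z /G mulr_sumr mulr_suml mulr_sumr -big_split /=.
  apply: ler_sum => n _; rewrite normcM.
  move: (normc (c n)) (normc (g n%:R)) => u v.
  have /mulr_ge0 := sqr_ge0 (B * u - v); move=> /(_ B^-1).
  rewrite invr_ge0 (ltW B0) => /(_ isT).
  have -> : (B * u - v) ^+ 2 / B = B * u ^+ 2 + v ^+ 2 / B - 2 * (u * v).
    by field; rewrite gt_eqF.
  lra.
have normb i : normc (b i) = normc (S i) by rewrite normc_conj.
have gram (k : R) : (normc (g k) ^+ 2)%:C%C =
    \sum_(i <- s) \sum_(j <- s) (b i * (b j)^*%C) * e (k * (x i - x j)).
  rewrite sqr_normcE /g rmorph_sum mulr_suml; apply: eq_bigr => i _.
  rewrite mulr_sumr; apply: eq_bigr => j _.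
  rewrite rmorphM [X in _ * (_ * X)]e_conj mulrBr eD; ring.
pose G2 := \sum_(0 <= j < M + M) \sum_(0 <= i < M + M) normc (g (i%:R - j%:R)) ^+ 2.
have G2_ge : M%:R * G <= G2.
  rewrite /G2 (big_cat_nat (n := M)) ?leq_addr //= -[leLHS]addr0 lerD //; last first.
    by do 2 apply: sumr_ge0 => ? _; rewrite exprn_ge0 ?normc_ge0.
  rewrite mulr_natl -[X in _ *+ X]subn0 -sumr_const_nat; apply: ler_sum_nat => j /= jM.
  rewrite (big_cat_nat (n := j.+1)) ?(leq_trans jM) ?leq_addr //=.
  rewrite (big_cat_nat (n := (M + j).+1) (m := j.+1)) /=; [|lia|lia].
  rewrite -[leLHS]add0r -[X in _ + X <= _]addr0 lerD // ?lerD //.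
  - by apply: sumr_ge0 => ? _; rewrite exprn_ge0 ?normc_ge0.
  - rewrite -addn1 -addSn addnC /G -addn1 big_addn.
    rewrite (_ : (M.+1 + j - j)%N = M.+1); last by rewrite addnK.
    by apply: ler_sum => i _; rewrite natrD addrK.
  - by apply: sumr_ge0 => ? _; rewrite exprn_ge0 ?normc_ge0.
have G2_le : G2 <= \sum_(i <- s) \sum_(j <- s) normc (S i) * normc (S j) * D i j.
  have G20 : 0 <= G2 by do 2 apply: sumr_ge0 => ? _; rewrite exprn_ge0 ?normc_ge0.
  rewrite -(normc_real G20).
  have -> : G2%:C%C = \sum_(i <- s) \sum_(j <- s)
      (b i * (b j)^*%C) * (D i j)%:C%C.
    transitivity (\sum_(0 <= i' < M + M) \sum_(0 <= j' < M + M)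
        \sum_(i <- s) \sum_(j <- s)
          (b i * (b j)^*%C) * e ((i'%:R - j'%:R) * (x i - x j))).
      rewrite /G2 exchange_big rmorph_sum; apply: eq_bigr => i' _.
      by rewrite rmorph_sum; apply: eq_bigr => j' _; exact: gram.
    under eq_bigr => i' _ do rewrite exchange_big.
    rewrite exchange_big; apply: eq_bigr => i _.
    under eq_bigr => i' _ do rewrite exchange_big.
    rewrite exchange_big; apply: eq_bigr => j _.
    rewrite /D -sum_e_diff mulr_sumr; apply: eq_bigr => i' _.
    by rewrite mulr_sumr.
  apply: le_trans (normc_sum _ _ _) _; apply: ler_sum => i _.
  apply: le_trans (normc_sum _ _ _) _; apply: ler_sum => j _.
  by rewrite !normcM (normc_conj (b j)) !normb normc_real ?exprn_ge0 ?normc_ge0.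
have Dsym i j : D i j = D j i.
  rewrite /D -normc_conj rmorph_sum; congr (normc _ ^+ 2).
  by apply: eq_bigr => n _; rewrite [LHS]e_conj -mulrN opprB.
(* Schur test: AM-GM and the symmetry of D reduce the quadratic form to row sums of the Gram matrix,
   which the hypothesis bounds. *)
have G2_T : G2 <= T * (B * M%:R).
  apply: le_trans G2_le _.
  apply: (@le_trans _ _ (\sum_(i <- s) \sum_(j <- s)
      (normc (S i) ^+ 2 * D i j / 2 + normc (S j) ^+ 2 * D i j / 2))).
    apply: ler_sum => i _; apply: ler_sum => j _.
    have : 0 <= D i j by rewrite exprn_ge0 ?normc_ge0.
    move/(mulr_ge0 (sqr_ge0 (normc (S i) - normc (S j)))).
    move: (normc _) (normc _) (D _ _) => u v d; lra.
  under eq_bigr do rewrite big_split.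
  rewrite big_split /= [X in _ + X]exchange_big -big_split /=.
  rewrite /T mulr_suml big_seq [leRHS]big_seq; apply: ler_sum => i si.
  rewrite [X in _ + X](eq_bigr (fun j => normc (S i) ^+ 2 * D i j / 2)).
    rewrite -big_split /= (eq_bigr (fun j => normc (S i) ^+ 2 * D i j)).
      rewrite -mulr_sumr; apply: ler_wpM2l; last exact: bound.
      by rewrite exprn_ge0 ?normc_ge0.
    by move=> j _; lra.
  by move=> j _; rewrite Dsym.
have GT : G / B <= T.
  rewrite ler_pdivrMr // -(ler_pM2l M0').
  by apply: le_trans G2_ge _; rewrite mulrC -mulrA.
by rewrite /T /Z in T_le GT *; lra.
Qed.

Lemma sum_inv_sqr_le (R : realType) (J : nat) :
  \sum_(1 <= j < J) (j%:R ^+ 2)^-1 <= 2 :> R.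
Proof.
suff: forall n, \sum_(1 <= j < n.+2) (j%:R ^+ 2)^-1 <= 2 - n.+1%:R^-1 :> R.
  case: J => [|[|n]] h; [by rewrite big_geq|by rewrite big_geq|].
  by apply: le_trans (h n) _; rewrite gerBl invr_ge0.
elim=> [|n IHn]; first by rewrite big_nat1 expr1n !invr1; lra.
rewrite big_nat_recr //=; move: IHn; set s := \sum_(_ <= _ < _) _ => IHn.
rewrite -[n.+2]addn1 natrD; move: IHn; set m := n.+1%:R => IHn.
have m0 : 0 < m by rewrite ltr0n.
suff : (m + 1) ^- 2 <= m^-1 - (m + 1)^-1 by move: (m ^-1) IHn => u; lra.
have -> : m^-1 - (m + 1)^-1 = (m * (m + 1))^-1.
  by field; rewrite !gt_eqF // addr_gt0.
rewrite lef_pV2 ?posrE ?exprn_gt0 ?mulr_gt0 ?addr_gt0 //; nra.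
Qed.

(** Clustering of the points costs a factor K. The squared kernel is at most 4 N^2 and decays like
    the inverse square of the distance, so a row of the Gram matrix sums to O(K N^2). *)
Lemma large_sieve (R : realType) (I : eqType) (s : seq I) (x : I -> R)
    (c : nat -> R[i]) (N : R) (K : nat) : 1 <= N ->
    (forall i t, i \in s -> (count (fun j =>
       (t <= centered_frac (x i - x j) <= t + (4 * N)^-1)%R) s <= K)%N) ->
  \sum_(i <- s) normc (expsum c N (x i)) ^+ 2 <= 12 ^+ 2 * K%:R * N * sqnorm c N.
Proof.
move=> N1 cntK; have N0 : 0 < N by lra.
set M := Num.truncn N.
have M0 : (0 < M)%N by rewrite truncn_gt0.
have M1 : (1 : R) <= M%:R by rewrite ler1n.
have /andP[MN NM] := truncn_itv (ltW N0); rewrite -/M -natr1 in MN NM.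
have [K0|K0] := posnP K; last first.
  apply: large_sieve_duality => // [|i si].
    by rewrite mulr_gt0 // mulr_gt0 ?ltr0n // exprn_gt0.
  (* At distance at least j / (4 N) the geometric sum is at most 4 N / j; for j = 0 its length 2 M
     <= 2 N is used. *)
  pose f (j : nat) : R := if j == 0%N then 4 * N ^+ 2 else 16 * N ^+ 2 / j%:R ^+ 2.
  have f0 j : 0 <= f j.
    by rewrite /f; case: ifP => _; rewrite ?divr_ge0 ?mulr_ge0 ?exprn_ge0 // ltW.
  have eta0 : 0 < (4 * N)^-1 by rewrite invr_gt0 mulr_gt0.
  pose J := ((2 * M.+1).+1)%N.
  have etaJ : 1 / 2 < J%:R * (4 * N)^-1.
    have -> : J%:R = 2 * (M%:R + 1) + 1 :> R by rewrite natr1 -natrM natr1.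
    rewrite ltr_pdivlMr ?mulr_gt0 //.
    by move: (M%:R : R) NM => m; lra.
  have := bucket_sum (x := fun j => x i - x j)
    (F := fun j => normc (\sum_(0 <= n < M + M) e (n%:R * (x i - x j))) ^+ 2)
    eta0 etaJ (cntK i ^~ si) f0.
  move=> /(_ ltac:(idtac)) h; apply: le_trans (h _) _.
    move=> j k sj; rewrite /f; set u := normc _; set r := `|_|.
    have u0 : 0 <= u by exact: normc_ge0.
    case: eqP => [_ _|/eqP]; last first.
      rewrite -lt0n -(ltr0n R) => k0; rewrite ler_pdivrMr ?mulr_gt0 // => kr.
      have ur : u * r <= 1 by exact: geometric_e_le_frac.
      rewrite ler_pdivlMr ?exprn_gt0 //.
      have uk : u * k%:R <= 4 * N.
        have := ler_wpM2l u0 kr; have := ler_wpM2r (ltW N0) ur; lra.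
      rewrite -exprMn (_ : 16 * N ^+ 2 = (4 * N) ^+ 2); last by ring.
      by rewrite ler_pXn2r ?nnegrE ?mulr_ge0 // ltW.
    have uM : u <= 2 * N.
      apply: le_trans (geometric_e_le_size _ _ _) _.
      by rewrite subn0 natrD; lra.
    have -> : 4 * N ^+ 2 = (2 * N) ^+ 2 by ring.
    by rewrite ler_pXn2r ?nnegrE // mulr_ge0 // ltW.
  (* 144 = 2 (4 + 32) * 2: two arcs per bucket, the bucket j = 0, the tail 16 * 2, and N <= 2 M. *)
  have -> : 12 ^+ 2 * K%:R * N * M%:R = 2 * K%:R * (72 * N * M%:R) :> R by ring.
  apply: ler_wpM2l; first by rewrite mulr_ge0.
  rewrite big_ltn // {1}/f eqxx.
  have : \sum_(1 <= j < J) f j <= 32 * N ^+ 2.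
    rewrite (eq_big_nat _ _ (F2 := fun j => 16 * N ^+ 2 * (j%:R ^+ 2)^-1)); last first.
      by move=> [].
    rewrite -mulr_sumr; have := sum_inv_sqr_le R J.
    by move/(ler_wpM2l (_ : 0 <= 16 * N ^+ 2)) => /(_ ltac:(nra)); lra.
  have NM2 : N <= 2 * M%:R by lra.
  have := ler_wpM2l (ltW N0) NM2.
  by rewrite expr2; move: (\sum_(_ <= _ < _) _) => w; lra.
(* For K = 0 the list must be empty, since any i is itself counted in the arc with t = 0. *)
rewrite K0 in cntK *; case: s cntK => [|i s] cntK; first by rewrite big_nil !mulr0 !mul0r.
have := cntK i 0 (mem_head _ _).
have frac0 : centered_frac (0 : R) = 0.
  have f0 : Num.floor (1 / 2 : R) = 0.
    by apply: floor_def; rewrite add0r; apply/andP; split; lra.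
  by rewrite /centered_frac (add0r (1 / 2)) f0 subrr.
by rewrite /= subrr frac0 lexx add0r invr_ge0 mulr_ge0 ?(ltW N0).
Qed.

(** * Beta close to a fraction with small denominator *)

Lemma card_le_sum_fibers (T : finType) (J : eqType) (A : {set T}) (js : seq J)
    (key : T -> J) : {in A, forall q, key q \in js} ->
  (#|A| <= \sum_(j <- js) #|[set q in A | key q == j]|)%N.
Proof.
move=> keyP; rewrite -sum1_card.
under [leqRHS]eq_bigr do rewrite cardE -sum1_size big_enum_cond.
apply: (@leq_trans (\sum_(q in A) \sum_(j <- js | key q == j) 1)%N).
  apply: leq_sum => q qA; rewrite sum1_count -has_count.
  by apply/hasP; exists (key q); rewrite ?keyP //=.
rewrite (exchange_big_dep predT) //=; apply: leq_sum => j _.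
rewrite [leqLHS](eq_bigl (fun q => (q \in [set q in A | key q == j]) && true)) // => q.
by rewrite andbT inE.
Qed.

Lemma size_le_injective (T : eqType) (s : seq T) (f : T -> nat) (K : nat) :
  uniq s -> {in s &, injective f} -> {in s, forall x, (f x < K)%N} ->
  (size s <= K)%N.
Proof.
move=> us inj_f fK; rewrite -(size_map f) -(size_iota 0 K).
apply: uniq_leq_size; first by rewrite map_inj_in_uniq.
by move=> _ /mapP[x sx ->]; rewrite mem_iota add0n fK.
Qed.

Lemma dvdn_sub_of_absz (s q q' : nat) :
  (s %| `|q%:Z - q'%:Z|)%N -> (s %| q - q')%N.
Proof.
case: (leqP q' q) => [le_q|/ltnW le_q]; first by rewrite subzn.
by rewrite (eqP le_q).
Qed.

Lemma mem_signed_iota (k : int) (K : nat) : k != 0 -> (`|k| <= K)%N ->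
  k \in [seq n%:Z | n <- iota 1 K] ++ [seq - n%:Z | n <- iota 1 K].
Proof.
move=> k0 kK; have mem : `|k|%N \in iota 1 K by rewrite mem_iota; lia.
rewrite mem_cat; case: (lerP 0 k) => k1; apply/orP; [left|right];
  by apply/mapP; exists `|k|%N => //; lia.
Qed.

(** After subtraction of the least element, the set consists of multiples of s in [0, L]. *)
Lemma card_spaced (R : realType) (n s : nat) (B : {set 'I_n}) (L : R) :
  (0 < s)%N -> 0 <= L ->
  {in B &, forall q q' : 'I_n, (s %| q - q')%N} ->
  {in B &, forall q q' : 'I_n, `|q%:R - q'%:R| <= L} ->
  #|B|%:R <= 1 + L / s%:R.
Proof.
move=> s0 L0 sdvd qL; have s0' : 0 < s%:R :> R by rewrite ltr0n.
have Ls0 : 0 <= L / s%:R by rewrite divr_ge0 // ltW.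
have [->|/set0Pn[q1 Bq1]] := eqVneq B finset.set0; first by rewrite cards0 addr_ge0.
have [q0 Bq0 q0_min] := arg_minnP (@nat_of_ord n) Bq1.
suff cardB : (#|B| <= (Num.truncn (L / s%:R)).+1)%N.
  apply: le_trans (_ : (Num.truncn (L / s%:R)).+1%:R <= _); first by rewrite ler_nat.
  by rewrite -natr1 addrC lerD2l; have /andP[] := truncn_itv Ls0.
rewrite cardE; apply: (@size_le_injective _ _ (fun q : 'I_n => (q - q0) %/ s)%N).
- exact: enum_uniq.
- move=> q q'; rewrite !mem_enum => Bq Bq' eq_div; apply: val_inj => /=.
  have := q0_min _ Bq; have := q0_min _ Bq'.
  have := divnK (sdvd _ _ Bq Bq0); have := divnK (sdvd _ _ Bq' Bq0).
  by rewrite eq_div; lia.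
- move=> q; rewrite mem_enum => Bq; rewrite ltnS truncn_ge_nat //.
  rewrite ler_pdivlMr // -natrM divnK ?sdvd // natrB ?q0_min //.
  by apply: le_trans (qL _ _ Bq Bq0); exact: ler_norm.
Qed.

(** The map k -> c k / h is injective on the counted k, with positive values at most c K / h. With c
    = 4 and h = g^2 it bounds the number of m for which a large square divides 4 m. *)
Lemma count_dvdn_mul (h c K : nat) : (0 < h)%N -> (0 < c)%N ->
  (count (fun k => h %| c * k) (iota 1 K) * h <= c * K)%N.
Proof.
move=> h0 c0; rewrite -leq_divRL // -size_filter.
apply: (@size_le_injective _ _ (fun k => (c * k %/ h).-1)).
- by rewrite filter_uniq ?iota_uniq.
- move=> k k'; rewrite !mem_filter !mem_iota => /andP[dk k0] /andP[dk' k0'] eq_div.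
  have p1 : (0 < c * k %/ h)%N by rewrite divn_gt0 // dvdn_leq // muln_gt0 c0; lia.
  have p2 : (0 < c * k' %/ h)%N by rewrite divn_gt0 // dvdn_leq // muln_gt0 c0; lia.
  have /(congr1 (muln ^~ h)) : (c * k %/ h)%N = (c * k' %/ h)%N by lia.
  by rewrite !divnK // => /eqP; rewrite eqn_pmul2l // => /eqP.
- move=> k; rewrite mem_filter mem_iota => /andP[dk k0].
  have p1 : (0 < c * k %/ h)%N by rewrite divn_gt0 // dvdn_leq // muln_gt0 c0; lia.
  rewrite prednK // leq_div2r // leq_mul2l; lia.
Qed.

(* Square roots of a fixed residue mod r: splitting q by d = gcd(q - q0, r) forces
   q = q0 mod d and q = -q0 mod r/d. *)
Lemma sqr_congr_split (q q0 r : nat) : (0 < r)%N ->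
  (r%:Z %| q%:Z ^+ 2 - q0%:Z ^+ 2)%Z ->
  let d := gcdn `|q%:Z - q0%:Z| r in
  [/\ (d %| r)%N, (d%:Z %| q%:Z - q0%:Z)%Z &
      ((r %/ d)%N%:Z %| q%:Z + q0%:Z)%Z].
Proof.
move=> r0 rdvd d; have dr : (d %| r)%N by exact: dvdn_gcdr.
have d0 : (0 < d)%N by rewrite gcdn_gt0 r0 orbT.
have dx : (d %| `|q%:Z - q0%:Z|)%N by exact: dvdn_gcdl.
split=> //; move: rdvd; rewrite subr_sqr !dvdzE !absz_nat abszM.
rewrite -{1}(divnK dr) -{1}(divnK dx) mulnAC dvdn_pmul2r // Gauss_dvdr //.
by rewrite /coprime gcdnC -(eqn_pmul2r d0) mul1n muln_gcdl !divnK.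
Qed.

(* Write m = b r - b0 q^2.  Solutions with m = 0 satisfy q^2 = r.  For given m != 0
   and d = gcd(q - q0, r), where q0 is a base solution with the same m, the q lie in
   one class modulo lcm(d, r/d) = r/g, with g = gcd(d, r/d) and g^2 | 4m, and in an
   interval of length 2 Q Delta / W. *)
Lemma card_near_rational (R : realType) (n r : nat) (b0 : int)
    (beta Delta Q : R) (A : {set 'I_n}) (b : 'I_n -> int) :
  let W := `|beta - b0%:~R / r%:R| + Delta in
  (0 < r)%N -> coprime `|b0| r -> 0 < Delta -> 0 <= Q ->
  {in A, forall q : 'I_n, [/\ (0 < q)%N, q%:R <= Q, coprime `|b q| q &
     `|(b q)%:~R - q%:R ^+ 2 * beta| <= q%:R ^+ 2 * Delta]} ->
  #|A|%:R <= 1 + (size (divisors r))%:R *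
    (2 * Q ^+ 2 * r%:R * W + 16 * Q ^+ 3 * Delta).
Proof.
move=> W r0 cop_b0 Delta0 Q0 AP.
have r0' : 0 < r%:R :> R by rewrite ltr0n.
pose z := beta - b0%:~R / r%:R; have WE : W = `|z| + Delta by [].
have W0 : 0 < W by rewrite ltr_wpDl.
pose m (q : 'I_n) : int := b q * r%:Z - b0 * q%:Z ^+ 2.
pose err (q : 'I_n) : R := (b q)%:~R - q%:R ^+ 2 * beta.
have mE q : (m q)%:~R = r%:R * err q + q%:R ^+ 2 * r%:R * z :> R.
  rewrite /m /err /z expr2 intrB !intrM -!pmulrn.
  by field; rewrite gt_eqF.
have errP q : q \in A -> - (q%:R ^+ 2 * Delta) <= err q <= q%:R ^+ 2 * Delta.
  by move=> /AP[_ _ _]; rewrite ler_norml.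
have m_le q : q \in A -> `|(m q)%:~R| <= Q ^+ 2 * r%:R * W.
  move=> qA; have [_ qQ _ herr] := AP q qA.
  rewrite mE; apply: le_trans (ler_normD _ _) _.
  rewrite (normrM r%:R) (normrM (_ * _) z) (ger0_norm (ltW r0')).
  rewrite (ger0_norm (mulr_ge0 (exprn_ge0 _ (ler0n _ _)) (ltW r0'))).
  apply: (@le_trans _ _ (q%:R ^+ 2 * r%:R * W)).
    rewrite WE mulrDr addrC lerD2l -mulrA mulrCA.
    by apply: ler_wpM2l; rewrite ?(ltW r0').
  do 2 (apply: ler_wpM2r; first by rewrite ltW).
  by rewrite ler_pXn2r ?nnegrE.
(* W is |z| + Delta because two bounds are added: equal m give (q^2 - q'^2) z = err q' - err q, so
   division by q + q' yields |q - q'| |z| <= Q Delta, and |q - q'| <= Q is trivial. *)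
have close q q' : q \in A -> q' \in A -> m q = m q' ->
    `|q%:R - q'%:R| <= 2 * Q * Delta / W.
  move=> qA q'A mm; rewrite ler_pdivlMr // WE mulrDr.
  have [p1 qQ _ _] := AP q qA; have [p2 q'Q _ _] := AP q' q'A.
  rewrite -(ltr0n R) in p1; rewrite -(ltr0n R) in p2.
  have h1 : `|q%:R - q'%:R| * `|z| <= Q * Delta.
    rewrite -normrM.
    have eq_err : (q%:R ^+ 2 - q'%:R ^+ 2) * z = err q' - err q.
      have := congr1 (fun k : int => k%:~R : R) mm; rewrite !mE => h.
      apply: (mulfI (lt0r_neq0 r0')); lra.
    have s0 : 0 < q%:R + q'%:R :> R by rewrite addr_gt0.
    rewrite -(ler_pM2l s0) -{1}(gtr0_norm s0) -normrM.
    rewrite (_ : (q%:R + q'%:R) * ((q%:R - q'%:R) * z) = err q' - err q); last first.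
      by rewrite -eq_err; ring.
    apply: (@le_trans _ _ (q'%:R ^+ 2 * Delta + q%:R ^+ 2 * Delta)).
      have := errP _ qA; have := errP _ q'A; rewrite ler_norml.
      move: (err q) (err q') (_ * Delta) (_ * Delta) => u v w x; clear.
      by move=> /andP[? ?] /andP[? ?]; apply/andP; split; lra.
    rewrite -mulrDl mulrA; apply: ler_wpM2r; first exact: ltW.
    by rewrite !expr2; nra.
  have h2 : `|q%:R - q'%:R| * Delta <= Q * Delta.
    apply: ler_wpM2r; first exact: ltW.
    rewrite ler_norml; move: qQ q'Q p1 p2; clear; move: (q%:R) (q'%:R) => u v *.
    by apply/andP; split; lra.
  by move: h1 h2; clear; lra.
(* The base solution depends only on m q, so it is common to all q with the same m. The default 0 in
   [dd] never arises for q in A, where q itself is a candidate. *)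
pose base (q : 'I_n) := [pick q' in A | m q' == m q].
pose dd (q : 'I_n) := if base q is Some q0 then gcdn `|q%:Z - q0%:Z| r else 0%N.
pose K := Num.truncn (Q ^+ 2 * r%:R * W).
have M0 : 0 <= Q ^+ 2 * r%:R * W.
  by rewrite !mulr_ge0 ?exprn_ge0 // ltW.
have /andP[KM _] := truncn_itv M0; rewrite -/K in KM.
pose A0 := [set q in A | m q == 0]; pose A1 := [set q in A | m q != 0].
have cardA : (#|A| <= #|A0| + #|A1|)%N.
  rewrite -(cardsID [set q | m q == 0] A) leq_add //; apply: subset_leq_card;
    by apply/fintype.subsetP => q; rewrite !inE // andbC.
have cardA0 : (#|A0| <= 1)%N.
  suff sq q : q \in A0 -> (q ^ 2)%N = r.
    apply/card_le1_eqP => q q' /sq e1 /sq e2; apply: val_inj => /=.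
    by apply/eqP; rewrite -(@eqn_exp2r _ _ 2) // e1 e2.
  rewrite inE /m subr_eq0 => /andP[qA /eqP/(congr1 absz)].
  have [q0 _ cop_b _] := AP q qA.
  rewrite !abszM !absz_nat mulnn => eqbr; apply/eqP; rewrite eqn_dvd; apply/andP; split.
    rewrite -(@Gauss_dvdr _ `|b q|); first by rewrite eqbr; exact: dvdn_mull.
    by rewrite coprimeXl // coprime_sym.
  rewrite -(@Gauss_dvdr _ `|b0|); first by rewrite -eqbr; exact: dvdn_mull.
  by rewrite coprime_sym.
have split q : q \in A -> exists q0, [/\ base q = Some q0, q0 \in A & m q0 = m q].
  move=> qA; rewrite /base; case: pickP => [q0 /andP[q0A /eqP mq0]|/(_ q)].
    by exists q0.
  by rewrite qA eqxx.
have splitP q q0 : q \in A -> base q = Some q0 -> q0 \in A -> m q0 = m q ->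
    [/\ (dd q %| r)%N, ((dd q)%:Z %| q%:Z - q0%:Z)%Z &
        ((r %/ dd q)%N%:Z %| q%:Z + q0%:Z)%Z].
  move=> qA bq q0A mq; rewrite /dd bq; apply: sqr_congr_split => //.
  have cop : coprimez r%:Z b0 by rewrite coprimezE absz_nat coprime_sym.
  rewrite -(Gauss_dvdzr _ cop).
  apply/dvdzP; exists (b q - b q0); move: mq; rewrite /m.
  move: (b q) (b q0) (q%:Z ^+ 2) (q0%:Z ^+ 2) (r%:Z) => u v w x y; clear; lra.
pose zs : seq int := [seq k%:Z | k <- iota 1 K] ++ [seq - k%:Z | k <- iota 1 K].
pose js := [seq (d, k) | d <- divisors r, k <- zs].
have keyP : {in A1, forall q, (dd q, m q) \in js}.
  move=> q; rewrite inE => /andP[qA mq0].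
  have [q0 [bq q0A mq]] := split q qA; have [dr _ _] := splitP q q0 qA bq q0A mq.
  apply: allpairs_f; first by rewrite -dvdn_divisors.
  have mK : (`|m q| <= K)%N.
    by rewrite /K truncn_ge_nat // natr_absz intr_norm m_le.
  exact: mem_signed_iota.
pose g (d : nat) := gcdn d (r %/ d).
have gr d : (d %| r)%N -> (0 < g d)%N.
  by move=> dr; rewrite gcdn_gt0 (dvdn_gt0 r0 dr).
pose L := 2 * Q * Delta / W.
have L0 : 0 <= L by rewrite divr_ge0 ?mulr_ge0 // ltW.
have fiber (d : nat) (k : int) : (d %| r)%N ->
    #|[set q in A1 | (dd q, m q) == (d, k)]|%:R <=
    1 + (if (g d ^ 2 %| 4 * `|k|)%N then L * (g d)%:R / r%:R else 0).
  move=> dr; set B := [set _ in _ | _]; have g0 := gr d dr.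
  have BP q : q \in B -> [/\ q \in A, dd q = d & m q = k].
    by rewrite !inE xpair_eqE => /andP[/andP[qA _] /andP[/eqP dq /eqP mq]].
  have lcmE : (lcmn d (r %/ d) * g d)%N = r by rewrite muln_lcm_gcd mulnC divnK.
  have [B0|/set0Pn[q1 Bq1]] := eqVneq B finset.set0.
    rewrite B0 cards0 addr_ge0 //; case: ifP => // _.
    by apply: divr_ge0 => //; apply: mulr_ge0.
  have [q1A dq1 mq1] := BP _ Bq1.
  have [q0 [bq1 q0A mq0]] := split q1 q1A.
  have all_base q : q \in B -> base q = Some q0.
    by move=> /BP[_ _ mq]; rewrite -bq1 /base; apply: eq_pick => q'; rewrite mq mq1.
  (* g divides q1 - q0 and q1 + q0, hence 2 q1, and g^2 divides d (r/d) = r. So g^2 divides 4 b r -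
     b0 (2 q1)^2 = 4 m. *)
  have g2 : (g d ^ 2 %| 4 * `|k|)%N.
    have [_] := splitP q1 q0 q1A bq1 q0A mq0; rewrite dq1 => d1 d2.
    have g2r : ((g d)%:Z ^+ 2 %| r%:Z)%Z.
      rewrite dvdzE abszX !absz_nat -(divnK dr) mulnC expnS expn1.
      by rewrite dvdn_mul ?dvdn_gcdl ?dvdn_gcdr.
    have g2q : ((g d)%:Z ^+ 2 %| (2 * q1%:Z) ^+ 2)%Z.
      apply: dvdz_exp2r; rewrite (_ : 2 * q1%:Z = (q1%:Z - q0%:Z) + (q1%:Z + q0%:Z)); last by ring.
      by apply: rpredD; [apply: dvdz_trans d1|apply: dvdz_trans d2];
        rewrite dvdzE !absz_nat ?dvdn_gcdl ?dvdn_gcdr.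
    have : ((g d)%:Z ^+ 2 %| 4 * k)%Z.
      rewrite -mq1 /m (_ : 4 * _ = 4 * b q1 * r%:Z - b0 * (2 * q1%:Z) ^+ 2); last by ring.
      by rewrite rpredB // dvdz_mull.
    by rewrite dvdzE abszX abszM absz_nat.
  rewrite g2.
  have -> : L * (g d)%:R / r%:R = L / (lcmn d (r %/ d))%:R.
    rewrite -[X in _ / X%:R = _]lcmE natrM; field.
    by rewrite !pnatr_eq0 -!lt0n g0 lcmn_gt0 (dvdn_gt0 r0 dr) divn_gt0 ?(dvdn_gt0 r0 dr) //
      dvdn_leq.
  apply: card_spaced => //.
  - by rewrite lcmn_gt0 (dvdn_gt0 r0 dr) divn_gt0 ?(dvdn_gt0 r0 dr) // dvdn_leq.
  - move=> q q' Bq Bq'; have [qA dq mq] := BP _ Bq; have [q'A dq' mq'] := BP _ Bq'.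
    have [_] := splitP q q0 qA (all_base _ Bq) q0A ltac:(by rewrite mq0 mq mq1).
    have [_] := splitP q' q0 q'A (all_base _ Bq') q0A ltac:(by rewrite mq0 mq' mq1).
    rewrite dq dq' => e1 e2 e3 e4.
    have f1 : (d%:Z %| q%:Z - q'%:Z)%Z.
      have -> : q%:Z - q'%:Z = (q%:Z - q0%:Z) - (q'%:Z - q0%:Z) by ring.
      exact: rpredB.
    have f2 : ((r %/ d)%N%:Z %| q%:Z - q'%:Z)%Z.
      have -> : q%:Z - q'%:Z = (q%:Z + q0%:Z) - (q'%:Z + q0%:Z) by ring.
      exact: rpredB.
    have : (lcmn d (r %/ d) %| `|q%:Z - q'%:Z|)%N by rewrite dvdn_lcm; apply/andP.
    exact: dvdn_sub_of_absz.
  - move=> q q' Bq Bq'; have [qA dq mq] := BP _ Bq; have [q'A dq' mq'] := BP _ Bq'.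
    by apply: close; rewrite // mq mq'.
have cardA1 : #|A1|%:R <= (size (divisors r))%:R *
    (2 * Q ^+ 2 * r%:R * W + 16 * Q ^+ 3 * Delta).
  have := card_le_sum_fibers keyP; rewrite -(ler_nat R) => h; apply: le_trans h _.
  rewrite natr_sum /js big_allpairs /=.
  rewrite -sum1_size natr_sum mulr_suml big_seq [leRHS]big_seq; apply: ler_sum => d.
  rewrite -dvdn_divisors // mul1r => dr; have g0 := gr d dr.
  have g0' : 0 < (g d)%:R :> R by rewrite ltr0n.
  apply: le_trans (ler_sum _ (fun k _ => fiber d k dr)) _.
  pose half := \sum_(k <- iota 1 K)
    (1 + (if (g d ^ 2 %| 4 * k)%N then L * (g d)%:R / r%:R else 0)).
  rewrite (_ : \sum_(_ <- _) _ = half + half); last first.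
    rewrite /zs big_cat !big_map; congr (_ + _).
    by apply: eq_bigr => k _; rewrite abszN.
  suff : half <= Q ^+ 2 * r%:R * W + 8 * Q ^+ 3 * Delta by lra.
  rewrite /half big_split; apply: lerD.
    by rewrite big_const_seq iter_addr_0 count_predT size_iota.
  rewrite -big_mkcond big_const_seq iter_addr_0 /=.
  (* At most 4 K / g^2 values k contribute, each L g / r, so the rarity of large squares outweighs
     the loss g. One factor g is dropped, and W cancels in 4 Q^2 r W L / r = 8 Q^3 Delta. *)
  set cnt := count _ _.
  have : (cnt * g d ^ 2 <= 4 * K)%N by apply: count_dvdn_mul; rewrite ?expn_gt0 ?g0.
  rewrite -(ler_nat R) !natrM -expr2 => hc.
  have {hc}hc : cnt%:R * (g d)%:R ^+ 2 <= 4 * (Q ^+ 2 * r%:R * W).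
    by apply: le_trans hc _; rewrite ler_wpM2l.
  have g1 : 1 <= (g d)%:R :> R by rewrite ler1n.
  have {hc}hc : cnt%:R * (g d)%:R <= 4 * (Q ^+ 2 * r%:R * W).
    apply: le_trans hc; rewrite expr2 mulrA.
    by apply: ler_peMr => //; apply: mulr_ge0.
  rewrite -[leLHS]mulr_natl.
  apply: (@le_trans _ _ (4 * (Q ^+ 2 * r%:R * W) * (L / r%:R))).
    have -> : cnt%:R * (L * (g d)%:R / r%:R) = cnt%:R * (g d)%:R * (L / r%:R) by ring.
    by apply: ler_wpM2r => //; rewrite divr_ge0.
  rewrite /L le_eqVlt; apply/orP; left; apply/eqP.
  by field; rewrite !gt_eqF.
apply: le_trans (_ : #|A0|%:R + #|A1|%:R <= _); first by rewrite -natrD ler_nat.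
by apply: lerD => //; rewrite -[1]/(1%:R) ler_nat.
Qed.

(** * Weyl differencing *)

Lemma sum_uniq_sub (R : numDomainType) (T : eqType) (s1 s2 : seq T) (F : T -> R) :
  uniq s1 -> {subset s1 <= s2} -> (forall x, 0 <= F x) -> uniq s2 ->
  \sum_(x <- s1) F x <= \sum_(x <- s2) F x.
Proof.
move=> u1 s12 F0 u2.
have pe : perm_eq s1 [seq x <- s2 | x \in s1].
  apply: uniq_perm; rewrite ?filter_uniq // => x; rewrite mem_filter.
  by case s1x: (x \in s1) => //=; rewrite s12.
rewrite (perm_big _ pe) big_filter big_mkcond; apply: ler_sum => x _.
by case: ifP.
Qed.

Lemma sum_triangle (V : nmodType) (n : nat) (F : nat -> nat -> V) :
  \sum_(1 <= q < n) \sum_(q.+1 <= q' < n) F q' q =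
  \sum_(1 <= l < n) \sum_(1 <= q < n - l) F (q + l)%N q.
Proof.
under eq_bigr => q _.
  rewrite -add1n big_addn (big_nat_widen _ _ _ _ _ (leq_subr q n)); over.
rewrite (exchange_big_dep_nat xpredT) //=; apply: eq_bigr => l _.
rewrite [RHS](big_nat_widen _ _ _ _ _ (leq_subr l n)).
by apply: eq_big => [q|q _]; [lia|rewrite addnC].
Qed.

Lemma sum_square_split (V : nmodType) (n : nat) (F : nat -> nat -> V) :
  \sum_(1 <= q < n) \sum_(1 <= q' < n) F q q' =
  \sum_(1 <= q < n) F q q +
  (\sum_(1 <= l < n) \sum_(1 <= q < n - l) F (q + l)%N q +
   \sum_(1 <= l < n) \sum_(1 <= q < n - l) F q (q + l)%N).
Proof.
rewrite (eq_big_nat _ _ (F2 := fun q => F q q +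
  (\sum_(1 <= q' < q) F q q' + \sum_(q.+1 <= q' < n) F q q'))); last first.
  move=> q /andP[q1 qn]; rewrite (big_cat_nat (n := q)) ?(ltnW qn) //=.
  by rewrite (big_ltn (m := q)) // addrCA.
rewrite !big_split /=; congr (_ + (_ + _)); last exact: (sum_triangle n (fun a b => F b a)).
rewrite -(sum_triangle n F).
rewrite (eq_big_nat _ _ (F2 := fun q => \sum_(1 <= q' < n | (q' < q)%N) F q q')).
  rewrite (exchange_big_dep_nat xpredT) //=; apply: eq_bigr => q' _.
  by rewrite [RHS](big_nat_widenl _ 1).
by move=> q /andP[_ /ltnW qn]; rewrite (big_nat_widen _ _ _ _ _ qn).
Qed.

(** This is min(Q, 1/||t||), with ||t|| the distance from t to the nearest integer. Integral t is
    split off because the inverse of 0 is 0, which would make the minimum vanish. *)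
Definition geometric_majorant (R : realType) (Q t : R) : R :=
  if centered_frac t == 0 then Q else Num.min Q `|centered_frac t|^-1.

Lemma geometric_majorantP (R : realType) (Q t : R) : 0 <= Q ->
  [/\ 0 <= geometric_majorant Q t, geometric_majorant Q t <= Q &
      geometric_majorant Q t * `|centered_frac t| <= 1].
Proof.
move=> Q0; rewrite /geometric_majorant; case: eqP => [->|/eqP t0].
  by rewrite normr0 mulr0.
have p0 : 0 < `|centered_frac t| by rewrite normr_gt0.
by rewrite le_min Q0 invr_ge0 ltW // ge_min lexx -ler_pdivlMr // div1r ge_min lexx orbT.
Qed.

Lemma geometric_e_le_majorant (R : realType) (Q t : R) (a b : nat) :
  (b - a)%:R <= Q -> normc (\sum_(a <= n < b) e (n%:R * t)) <= geometric_majorant Q t.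
Proof.
move=> baQ; have le_Q := le_trans (geometric_e_le_size t a b) baQ.
rewrite /geometric_majorant; case: eqP => // /eqP t0.
rewrite le_min le_Q -div1r ler_pdivlMr ?normr_gt0 //.
exact: geometric_e_le_frac.
Qed.

Lemma centered_fracB (R : realType) (x y : R) :
  exists k : int, centered_frac x - centered_frac y = x - y - k%:~R.
Proof.
exists (Num.floor (x + 1 / 2) - Num.floor (y + 1 / 2)).
by rewrite /centered_frac intrB; ring.
Qed.

(* On a block of r/2 + 1 consecutive n, the points n beta are 1/(2r)-spaced mod 1. *)
Lemma majorant_block_sum (R : realType) (Q beta h : R) (r a : nat) (b0 : int) :
  0 <= Q -> (0 < r)%N -> coprime `|b0| r -> `|r%:R * beta - b0%:~R| <= 1 / r%:R ->
  \sum_(1 <= j < (2 * r).+1) (j%:R)^-1 <= h ->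
  \sum_(a <= n < a + (r %/ 2).+1) geometric_majorant Q (n%:R * beta) <=
    2 * (Q + 4 * r%:R * h).
Proof.
move=> Q0 r0 cop near harm; have r0' : 0 < r%:R :> R by rewrite ltr0n.
have gP n := geometric_majorantP (n%:R * beta) Q0.
pose f (j : nat) : R := if j == 0%N then Q else 4 * r%:R * (j%:R)^-1.
have eta0 : 0 < (4 * r%:R)^-1 :> R by rewrite invr_gt0 mulr_gt0.
have f0 j : 0 <= f j.
  by rewrite /f; case: ifP => // _; rewrite mulr_ge0 ?invr_ge0 // ltW // mulr_gt0.
set s := index_iota _ _.
(* The gaps are at least 1/(2r); the strict bound by 1/(4r) lets a closed arc of that length hold at
   most one point. *)
have spaced n n' : n \in s -> n' \in s -> (n' < n)%N ->
    (4 * r%:R)^-1 < `|centered_frac (n%:R * beta) - centered_frac (n'%:R * beta)|.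
  rewrite !mem_index_iota => sn sn' ltn.
  have [k ->] := centered_fracB (n%:R * beta) (n'%:R * beta).
  pose d := (n - n')%N; have d0 : (0 < d)%N by rewrite subn_gt0.
  have d2 : (2 * d <= r)%N by rewrite /d; lia.
  rewrite -mulrBl -natrB ?(ltnW ltn) // -/d.
  have near' : `|d%:R * (r%:R * beta - b0%:~R)| <= 1 / 2.
    rewrite normrM ger0_norm //; apply: le_trans (ler_wpM2l _ near) _ => //.
    rewrite mulrA mulr1 ler_pdivrMr //.
    by move: d2; rewrite -(ler_nat R) natrM; lra.
  (* d b0 - k r is a nonzero integer because 0 < d < r and b0 is prime to r; it outweighs the
     approximation error, which is at most 1/2. *)
  have far : 1 <= `|(d%:Z * b0 - k * r%:Z)%:~R| :> R.
    rewrite -intr_norm ler1z -gtz0_ge1 normr_gt0 subr_eq0; apply/negP => /eqP eqk.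
    have : (r %| d)%N.
      rewrite -(@Gauss_dvdl r d `|b0|) 1?coprime_sym //.
      by have := congr1 absz eqk; rewrite !abszM !absz_nat => ->; rewrite dvdn_mull.
    by move/(dvdn_leq d0); lia.
  rewrite -(ltr_pM2l r0') -[X in _ < X * _](gtr0_norm r0') -normrM.
  have -> : r%:R * (d%:R * beta - k%:~R) =
      d%:R * (r%:R * beta - b0%:~R) + (d%:Z * b0 - k * r%:Z)%:~R.
    by rewrite intrB !intrM -!pmulrn; ring.
  move: far near'; set u := (X in _ <= `|X|); set v := (X in `|X| <= _) => far near'.
  have : `|u| <= `|v + u| + `|v|.
    by have := ler_normB (v + u) v; rewrite addrAC subrr add0r.
  rewrite invfM mulrCA divff ?gt_eqF // mulr1; lra.
have cnt t : (count (fun n : nat =>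
    (t <= centered_frac (n%:R * beta) <= t + (4 * r%:R)^-1)%R) s <= 1)%N.
  rewrite -size_filter; apply: (@size_le_injective _ _ (fun=> 0%N)) => //.
    by rewrite filter_uniq ?iota_uniq.
  move=> n n'; rewrite !mem_filter => /andP[/andP[t1 t2] sn] /andP[/andP[t3 t4] sn'] _.
  have diff : `|centered_frac (n%:R * beta) - centered_frac (n'%:R * beta)|
      <= (4 * r%:R)^-1 by rewrite ler_norml; apply/andP; split; lra.
  case: (ltngtP n n') => // lt_n.
    by have := spaced _ _ sn' sn lt_n; rewrite distrC ltNge diff.
  by have := spaced _ _ sn sn' lt_n; rewrite ltNge diff.
have etaJ : 1 / 2 < (2 * r).+1%:R * (4 * r%:R)^-1 :> R.
  have -> : (2 * r).+1%:R = 2 * r%:R + 1 :> R by rewrite -natrM natr1.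
  by rewrite ltr_pdivlMr ?mulr_gt0 //; lra.
have := bucket_sum (F := fun n => geometric_majorant Q (n%:R * beta)) eta0 etaJ cnt f0.
move=> h1; apply: le_trans (h1 _) _ => [n j _ hj|].
  have [g1 g2 g3] := gP n; rewrite /f; case: eqP => // /eqP; rewrite -lt0n => j0.
  have j0' : 0 < j%:R :> R by rewrite ltr0n.
  rewrite ler_pdivlMr //; have := ler_wpM2l g1 hj; rewrite mulrA.
  rewrite ler_pdivrMr ?mulr_gt0 // => h2; apply: le_trans h2 _.
  by rewrite ler_piMl // mulr_ge0 // ltW.
rewrite mulr1; apply: ler_wpM2l => //.
rewrite big_ltn // {1}/f eqxx lerD2l.
rewrite (eq_big_nat _ _ (F2 := fun j => 4 * r%:R * (j%:R)^-1)); last by move=> [].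
by rewrite -mulr_sumr; apply: ler_wpM2l; rewrite ?mulr_ge0 // ltW.
Qed.

Lemma majorant_sum (R : realType) (Q beta h : R) (r M : nat) (b0 : int) :
  0 <= Q -> 0 <= h -> (0 < r)%N -> coprime `|b0| r ->
  `|r%:R * beta - b0%:~R| <= 1 / r%:R ->
  \sum_(1 <= j < (2 * r).+1) (j%:R)^-1 <= h ->
  \sum_(0 <= n < M) geometric_majorant Q (n%:R * beta) <=
    (2 * M%:R / r%:R + 1) * (2 * (Q + 4 * r%:R * h)).
Proof.
move=> Q0 h0 r0 cop near harm; have r0' : 0 < r%:R :> R by rewrite ltr0n.
have g0 n : 0 <= geometric_majorant Q (n%:R * beta).
  by have [] := geometric_majorantP (n%:R * beta) Q0.
set S := 2 * (_ + _); have S0 : 0 <= S by rewrite mulr_ge0 ?addr_ge0 ?mulr_ge0 // ltW.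
pose l := (r %/ 2).+1.
have blocks k : \sum_(0 <= n < k * l) geometric_majorant Q (n%:R * beta) <= k%:R * S.
  elim: k => [|k IHk]; first by rewrite mul0n big_geq // mul0r.
  rewrite mulSn addnC (big_cat_nat (n := (k * l)%N)) ?leq_addr //=.
  rewrite -natr1 mulrDl mul1r; apply: lerD => //.
  exact: (majorant_block_sum (k * l) Q0 r0 cop near harm).
apply: le_trans (_ : (M %/ l).+1%:R * S <= _).
  apply: le_trans (blocks _); rewrite [leRHS](big_cat_nat (n := M)) //=.
    by rewrite lerDl; apply: sumr_ge0.
  by rewrite ltnW // ltn_ceil.
apply: ler_wpM2r => //; rewrite -natr1 lerD2r ler_pdivlMr // -!natrM ler_nat.
have := leq_trunc_div M l; have : (r <= 2 * l)%N by rewrite /l; lia.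
move: (M %/ l)%N => k; nia.
Qed.

(** A pair with 2 h l = n is determined by the divisor h of n, so n arises at most [tau] times. This
    is where Weyl differencing pays a divisor bound. *)
Lemma sum_divisor_pairs (R : realType) (G : nat -> R) (H N tau : nat) :
  (forall n, 0 <= G n) -> (forall n, (0 < n < 2 * H * N)%N -> (size (divisors n) <= tau)%N) ->
  \sum_(1 <= h < H) \sum_(1 <= l < N) G (2 * h * l)%N <=
    tau%:R * \sum_(0 <= n < 2 * H * N) G n.
Proof.
move=> G0; have [M ME] : exists M, M = (2 * H * N)%N by exists (2 * H * N)%N.
rewrite -ME => tauP.
apply: (@le_trans _ _ (\sum_(1 <= h < H) \sum_(1 <= n < M | (h %| n)%N) G n)).
  rewrite big_seq [leRHS]big_seq; apply: ler_sum => h; rewrite mem_index_iota => /andP[h0 hH].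
  rewrite -(big_map (fun l => 2 * h * l)%N xpredT G) -[leRHS]big_filter.
  apply: sum_uniq_sub => //.
  - rewrite map_inj_uniq ?iota_uniq // => l l' /eqP.
    by rewrite eqn_pmul2l ?muln_gt0 // => /eqP.
  - move=> x /mapP[l]; rewrite mem_index_iota => /andP[l0 lN] ->.
    rewrite mem_filter mem_index_iota; apply/and3P; split.
    + by rewrite mulnAC dvdn_mull.
    + by rewrite !muln_gt0 h0 l0.
    + by rewrite ME -!mulnA ltn_pmul2l // ltn_mul.
  - by rewrite filter_uniq ?iota_uniq.
rewrite (exchange_big_dep_nat xpredT) //=.
apply: (@le_trans _ _ (\sum_(1 <= n < M) tau%:R * G n)); last first.
  rewrite -mulr_sumr; apply: ler_wpM2l => //.
  have drop0 k : \sum_(1 <= n < k) G n <= \sum_(0 <= n < k) G n.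
    case: k => [|k]; first by rewrite !big_geq.
    by rewrite [leRHS]big_ltn // lerDr.
  exact: drop0.
rewrite big_seq [leRHS]big_seq; apply: ler_sum => n; rewrite mem_index_iota => nM.
rewrite big_const_seq iter_addr_0 -[leLHS]mulr_natl; apply: ler_wpM2r => //.
rewrite ler_nat; apply: leq_trans (tauP n nM); rewrite -size_filter.
apply: uniq_leq_size; first by rewrite filter_uniq ?iota_uniq.
move=> h; rewrite mem_filter => /andP[hn _].
by rewrite -dvdn_divisors //; case/andP: nM.
Qed.

(** The frequency x is real because the Fejer kernel produces differences of indices, which may be
    negative. *)
Definition square_sum (R : realType) (N : nat) (beta x : R) : R[i] :=
  \sum_(1 <= q < N.+1) e (x * (q%:R ^+ 2 * beta)).

Lemma square_sumN (R : realType) (N : nat) (beta x : R) :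
  normc (square_sum N beta (- x)) = normc (square_sum N beta x).
Proof.
rewrite -normc_conj rmorph_sum; congr normc; apply: eq_bigr => q _.
by rewrite [LHS]e_conj mulNr opprK.
Qed.

Lemma square_sum0 (R : realType) (N : nat) (beta : R) :
  normc (square_sum N beta 0) = N%:R.
Proof.
rewrite /square_sum; under eq_bigr do rewrite mul0r e0.
by rewrite sumr_const_nat subn1 normc_natr.
Qed.

(* Weyl differencing: q = q' + l, with q^2 - q'^2 = 2 l q' + l^2. *)
Lemma sqr_square_sum_le (R : realType) (N h : nat) (Q beta : R) : N%:R <= Q ->
  normc (square_sum N beta h%:R) ^+ 2 <=
    N%:R + 2 * \sum_(1 <= l < N.+1) geometric_majorant Q ((2 * h * l)%:R * beta).
Proof.
move=> NQ; set S := square_sum _ _ _.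
have S0 : 0 <= normc S ^+ 2 by rewrite exprn_ge0 ?normc_ge0.
pose F q q' := e (h%:R * (q%:R ^+ 2 * beta)) * e (- (h%:R * (q'%:R ^+ 2 * beta))).
pose D := \sum_(1 <= l < N.+1) \sum_(1 <= q < N.+1 - l) F (q + l)%N q.
have SE : (normc S ^+ 2)%:C%C = N%:R + (D + D^*%C).
  rewrite sqr_normcE /S /square_sum rmorph_sum mulr_suml.
  under eq_bigr => q _.
    rewrite mulr_sumr; under eq_bigr => q' _ do rewrite [X in _ * X]e_conj -/(F q q').
    over.
  rewrite sum_square_split; congr (_ + (_ + _)).
    rewrite (eq_bigr (fun=> 1)) ?sumr_const_nat ?subn1 // => q _.
    by rewrite /F -eD subrr e0.
  rewrite /D rmorph_sum; apply: eq_bigr => l _; rewrite rmorph_sum.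
  by apply: eq_bigr => q _; rewrite rmorphM [X in X * _]e_conj [X in _ * X]e_conj opprK mulrC.
rewrite -(normc_real S0) SE.
apply: le_trans (le_normcD _ _) _; rewrite normc_natr lerD2l.
apply: le_trans (le_normcD _ _) _; rewrite (normc_conj D).
rewrite (_ : normc D + normc D = 2 * normc D); last by ring.
apply: ler_wpM2l => //; apply: le_trans (normc_sum _ _ _) _.
rewrite big_seq [leRHS]big_seq; apply: ler_sum => l; rewrite mem_index_iota => lN.
rewrite (eq_bigr (fun q => e (h%:R * l%:R ^+ 2 * beta) *
    e (q%:R * ((2 * h * l)%:R * beta)))); last first.
  by move=> q _; rewrite /F -!eD; congr e; rewrite !natrM natrD; ring.
rewrite -mulr_sumr normcM normc_e mul1r; apply: geometric_e_le_majorant.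
by apply: le_trans NQ; rewrite ler_nat; lia.
Qed.

(** All angles are at most pi/4 in absolute value, so no term cancels another: each real part is at
    least 1/2, by cos 2x >= 0. *)
Lemma dirichlet_kernel_ge (R : realType) (H : nat) (t : R) (b : int) :
  8 * H%:R * `|t - b%:~R| <= 1 ->
  H%:R / 2 <= normc (\sum_(1 <= h < H.+1) e (h%:R * t)).
Proof.
move=> near; rewrite (eq_bigr (fun h : nat => e (h%:R * (t - b%:~R)))); last first.
  move=> h _; rewrite -(eDint (h%:R * (t - b%:~R)) (h%:Z * b)); congr e.
  by rewrite intrM -pmulrn; ring.
apply: le_trans (Re_le_normc _); move: near; set u := t - b%:~R => near.
have -> : complex.Re (\sum_(1 <= h < H.+1) e (h%:R * u)) =
    \sum_(1 <= h < H.+1) cos (2 * pi * (h%:R * u)).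
  apply: (big_ind2 (fun z x => complex.Re z = x)) => // z1 x1 z2 x2 <- <-.
  by case: z1 z2 => [? ?] [? ?].
rewrite (_ : H%:R / 2 = \sum_(1 <= h < H.+1) (1 / 2)); last first.
  by rewrite sumr_const_nat subn1 -mulr_natr; lra.
rewrite big_seq [leRHS]big_seq; apply: ler_sum => h; rewrite mem_index_iota => hH.
have hu : `|h%:R * u| <= 1 / 8.
  rewrite normrM ger0_norm //.
  have : (h%:R : R) <= H%:R by rewrite ler_nat; lia.
  by move/(ler_wpM2r (normr_ge0 u)); lra.
move: (h%:R * u) hu => v; rewrite ler_norml => /andP[v1 v2].
have p0 := @pi_gt0 R.
have pv1 := mulr_ge0 (ltW p0) (_ : 0 <= v + 1 / 8).
have pv2 := mulr_ge0 (ltW p0) (_ : 0 <= 1 / 8 - v).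
move: pv1 pv2 => /(_ ltac:(lra)) pv1 /(_ ltac:(lra)) pv2.
set x := 2 * pi * v.
have c0 : 0 <= cos x.
  by apply: cos_ge0_pihalf; rewrite /x; move: (pi) p0 pv1 pv2 => p *; lra.
have c2 : 0 <= cos (x *+ 2).
  apply: cos_ge0_pihalf; rewrite /x -mulr_natl.
  by move: (pi) p0 pv1 pv2 => p *; lra.
rewrite cos_mulr2n in c2; have := cos_le1 x; nra.
Qed.

(** Every q in A gives the Fejer kernel a value of at least (H/2)^2. Summed over all q <= N, the
    kernel contributes H N from its diagonal, and each difference l or -l occurs at most H times. *)
Lemma card_sqr_near_int (R : realType) (H N n : nat) (beta : R)
    (A : {set 'I_n}) (b : 'I_n -> int) :
  {in A, forall q : 'I_n, [/\ (0 < q)%N, (q <= N)%N &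
     8 * H%:R * `|(b q)%:~R - q%:R ^+ 2 * beta| <= 1]} ->
  #|A|%:R * H%:R / 4 <= N%:R + 2 * \sum_(1 <= h < H.+1) normc (square_sum N beta h%:R).
Proof.
move=> AP; have [->|H0] := posnP H.
  by rewrite mulr0 mul0r big_geq // mulr0 addr0.
have H0' : 0 < H%:R :> R by rewrite ltr0n.
pose D (q : nat) := normc (\sum_(1 <= h < H.+1) e (h%:R * (q%:R ^+ 2 * beta))) ^+ 2.
have D0 q : 0 <= D q by rewrite exprn_ge0 ?normc_ge0.
set T := \sum_(_ <= _ < _) _.
have lower : #|A|%:R * (H%:R / 2) ^+ 2 <= \sum_(1 <= q < N.+1) D q.
  apply: (@le_trans _ _ (\sum_(q <- map val (enum A)) D q)).
    rewrite big_map big_enum -sum1_card natr_sum mulr_suml.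
    apply: ler_sum => q qA; rewrite mul1r.
    rewrite ler_pXn2r ?nnegrE ?normc_ge0 ?divr_ge0 //.
    have [_ _ near] := AP q qA.
    by apply: (dirichlet_kernel_ge (b := b q)); rewrite distrC.
  apply: sum_uniq_sub => //; rewrite ?iota_uniq //.
    by rewrite map_inj_uniq ?enum_uniq //; exact: val_inj.
  move=> x /mapP[q]; rewrite mem_enum => /AP[q0 qN _] ->.
  by rewrite mem_index_iota ltnS; apply/andP.
have upper : \sum_(1 <= q < N.+1) D q <= H%:R * (N%:R + 2 * T).
  have sum0 : 0 <= \sum_(1 <= q < N.+1) D q by apply: sumr_ge0.
  rewrite -(normc_real sum0).
  have -> : (\sum_(1 <= q < N.+1) D q)%:C%C = \sum_(1 <= i < H.+1)
      \sum_(1 <= j < H.+1) square_sum N beta (i%:R - j%:R).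
    rewrite rmorph_sum (eq_bigr _ (fun q _ => esym (sum_e_diff _ _ _))) exchange_big.
    by apply: eq_bigr => i _; rewrite exchange_big.
  apply: (@le_trans _ _ (\sum_(1 <= i < H.+1) \sum_(1 <= j < H.+1)
      normc (square_sum N beta (i%:R - j%:R)))).
    apply: le_trans (normc_sum _ _ _) _; apply: ler_sum => i _; exact: normc_sum.
  rewrite sum_square_split.
  under eq_bigr do rewrite subrr square_sum0.
  rewrite sumr_const_nat subn1 -[_ *+ _]mulr_natl mulrDr lerD2l.
  have half : \sum_(1 <= l < H.+1) \sum_(1 <= i < H.+1 - l)
      normc (square_sum N beta l%:R) <= H%:R * T.
    rewrite mulr_sumr big_seq [leRHS]big_seq; apply: ler_sum => l.
    rewrite mem_index_iota => lH; rewrite sumr_const_nat -[leLHS]mulr_natl.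
    by apply: ler_wpM2r; rewrite ?normc_ge0 // ler_nat; lia.
  rewrite (_ : H%:R * (2 * T) = H%:R * T + H%:R * T); last by ring.
  apply: lerD; apply: le_trans half; apply: ler_sum => l _; apply: ler_sum => i _.
    by rewrite natrD addrAC subrr add0r.
  by rewrite natrD opprD addrA subrr add0r square_sumN.
have := le_trans lower upper.
rewrite (_ : _ * (H%:R / 2) ^+ 2 = H%:R * (#|A|%:R * H%:R / 4)); last by field.
by rewrite ler_pM2l.
Qed.

Lemma card_large_denominator (R : realType) (y E beta : R) (n r : nat) (b0 : int)
    (A : {set 'I_n}) (b : 'I_n -> int) :
  1 <= y -> 1 <= E -> (0 < r)%N -> coprime `|b0| r ->
  `|r%:R * beta - b0%:~R| <= 1 / r%:R -> y ^+ 4 <= r%:R <= 2 * y ^+ 8 ->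
  (forall k, (0 < k)%N -> k%:R <= 8 * y ^+ 8 -> (size (divisors k))%:R <= E) ->
  (forall k, k%:R <= 8 * y ^+ 8 -> \sum_(1 <= j < k.+1) (j%:R)^-1 <= E) ->
  {in A, forall q : 'I_n, [/\ (0 < q)%N, q%:R <= y ^+ 5 &
     8 * y ^+ 2 * `|(b q)%:~R - q%:R ^+ 2 * beta| <= 1]} ->
  #|A|%:R <= 2 ^+ 12 * y ^+ 3 * E.
Proof.
move=> y1 E1 r0 cop near /andP[yr ry] tauE harmE AP.
have y0 : 0 < y by lra.
have yX k : 0 < y ^+ k by rewrite exprn_gt0.
have yle i j : (i <= j)%N -> y ^+ i <= y ^+ j by move=> ij; rewrite ler_weXn2l.
have r0' : 0 < r%:R :> R by rewrite ltr0n.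
set H := Num.truncn (y ^+ 2); set N := Num.truncn (y ^+ 5).
have /andP[Hy yH] := truncn_itv (ltW (yX 2%N)); rewrite -/H -natr1 in Hy yH.
have /andP[Ny _] := truncn_itv (ltW (yX 5%N)); rewrite -/N in Ny.
have H1 : 1 <= H%:R :> R by rewrite ler1n truncn_gt0 exprn_ege1.
have Hhalf : y ^+ 2 <= 2 * H%:R by lra.
have H0' : 0 < H%:R :> R by lra.
pose M := (2 * H.+1 * N.+1)%N.
have M7 : M%:R <= 8 * y ^+ 7.
  rewrite !natrM -!natr1 (_ : y ^+ 7 = y ^+ 2 * y ^+ 5); last by rewrite -exprD.
  have y5 := exprn_ege1 5 y1; have y2 := exprn_ege1 2 y1.
  have : (H%:R + 1) * (N%:R + 1) <= (2 * y ^+ 2) * (2 * y ^+ 5).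
    by apply: ler_pM; rewrite ?addr_ge0 //; lra.
  lra.
pose tau := Num.truncn E.
have E0 : 0 < E by lra.
have tauR : tau%:R <= E by have /andP[] := truncn_itv (ltW E0).
have M8 : M%:R <= 8 * y ^+ 8.
  by apply: le_trans M7 _; apply: ler_wpM2l => //; apply: yle.
have tauP k : (0 < k < M)%N -> (size (divisors k) <= tau)%N.
  move=> /andP[k0 kM]; rewrite truncn_ge_nat ?(ltW E0) //; apply: tauE => //.
  by apply: le_trans M8; rewrite ler_nat ltnW.
pose G k := geometric_majorant (y ^+ 5) (k%:R * beta).
have G0 k : 0 <= G k by have [] := geometric_majorantP (k%:R * beta) (ltW (yX 5%N)).
have harm : \sum_(1 <= j < (2 * r).+1) (j%:R)^-1 <= E.
  by apply: harmE; rewrite natrM; lra.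
(* The product y^7 / r * y^5 is at most y^8 since r >= y^4, and the term r E is controlled by r <= 2
   y^8. The constant is 32 + 128 + 2 + 16. *)
have sumG : \sum_(0 <= k < M) G k <= 178 * (y ^+ 8 * E).
  apply: le_trans (majorant_sum M (ltW (yX 5%N)) (ltW E0) r0 cop near harm) _.
  have hr : y ^+ 7 / r%:R * y ^+ 5 <= y ^+ 8.
    rewrite mulrAC ler_pdivrMr // -exprD (exprD y 8 4).
    by apply: ler_wpM2l => //; apply: ltW.
  have hr2 : y ^+ 7 / r%:R * r%:R = y ^+ 7 by rewrite divfK // gt_eqF.
  have hM : 2 * M%:R / r%:R + 1 <= 16 * (y ^+ 7 / r%:R) + 1.
    rewrite lerD2r ler_pdivrMr // -mulrA hr2; lra.
  have pos : 0 <= 2 * (y ^+ 5 + 4 * r%:R * E).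
    by rewrite mulr_ge0 // addr_ge0 ?mulr_ge0 // ltW.
  apply: le_trans (ler_wpM2r pos hM) _.
  have y78 := yle 7%N 8%N isT; have y58 := yle 5%N 8%N isT.
  have h1 := ler_wpM2r (ltW E0) y78; have h2 := ler_wpM2r (ltW E0) ry.
  have h3 := ler_wpM2l (ltW (yX 8%N)) E1.
  have -> : (16 * (y ^+ 7 / r%:R) + 1) * (2 * (y ^+ 5 + 4 * r%:R * E)) =
      32 * (y ^+ 7 / r%:R * y ^+ 5) + 128 * (y ^+ 7 / r%:R * r%:R) * E +
      2 * y ^+ 5 + 8 * (r%:R * E) by ring.
  rewrite hr2; move: hr y58 h1 h2 h3; clear.
  move: (y ^+ 7 / r%:R * y ^+ 5) (y ^+ 5) (y ^+ 7) (y ^+ 8) (r%:R) => u v w x z *; lra.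
have HN : H%:R * N%:R <= y ^+ 8 * E ^+ 2.
  apply: (@le_trans _ _ (y ^+ 8)).
    apply: le_trans (yle 7%N 8%N isT); rewrite (exprD y 2 5).
    by apply: ler_pM.
  by rewrite ler_peMr ?(ltW (yX 8%N)) // exprn_ege1.
pose s h := normc (square_sum N beta h%:R).
have U_le : \sum_(1 <= h < H.+1) s h ^+ 2 <= 357 * (y ^+ 8 * E ^+ 2).
  apply: (@le_trans _ _ (\sum_(1 <= h < H.+1)
      (N%:R + 2 * \sum_(1 <= l < N.+1) G (2 * h * l)%N))).
    by apply: ler_sum => h _; exact: sqr_square_sum_le.
  rewrite big_split /= -mulr_sumr sumr_const_nat subn1 -[_ *+ _]mulr_natl.
  have := sum_divisor_pairs G0 tauP; set D := \sum_(_ <= _ < _) _ => hD.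
  have : D <= E * (178 * (y ^+ 8 * E)).
    apply: le_trans hD _; apply: ler_pM => //.
    by apply: sumr_ge0.
  move: HN; clear; move: (y ^+ 8) => w; nra.
(* [lam] is the root mean square size of s h given by [U_le], up to a constant, so 2 s <= lam + s^2
   / lam replaces Cauchy-Schwarz without loss of order. *)
pose lam := y ^+ 3 * E.
have lam0 : 0 < lam by rewrite mulr_gt0.
have sum_s : 2 * \sum_(1 <= h < H.+1) s h <= 358 * (y ^+ 5 * E).
  apply: (@le_trans _ _ (\sum_(1 <= h < H.+1) (lam + s h ^+ 2 / lam))).
    rewrite mulr_sumr; apply: ler_sum => h _; rewrite -subr_ge0.
    rewrite (_ : _ - _ = (s h - lam) ^+ 2 / lam); last by field; rewrite gt_eqF.
    by rewrite divr_ge0 ?sqr_ge0 // ltW.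
  rewrite big_split /= sumr_const_nat subSS subn0 -[lam *+ H]mulr_natl.
  have <- : (\sum_(1 <= h < H.+1) s h ^+ 2) / lam =
      \sum_(1 <= h < H.+1) s h ^+ 2 / lam by rewrite mulr_suml.
  have h1 : H%:R * lam <= y ^+ 5 * E.
    rewrite /lam mulrA; apply: ler_wpM2r; first exact: ltW.
    by rewrite (exprD y 2 3); apply: ler_wpM2r => //; exact: ltW.
  have h2 : (\sum_(1 <= h < H.+1) s h ^+ 2) / lam <= 357 * (y ^+ 5 * E).
    rewrite ler_pdivrMr //; apply: le_trans U_le _; rewrite /lam.
    by rewrite le_eqVlt; apply/orP; left; apply/eqP; ring.
  by move: h1 h2; clear; lra.
have near_int : {in A, forall q : 'I_n, [/\ (0 < q)%N, (q <= N)%N &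
     8 * H%:R * `|(b q)%:~R - q%:R ^+ 2 * beta| <= 1]}.
  move=> q /AP[q0 qy hq]; split => //.
    by rewrite truncn_ge_nat // ltW.
  apply: le_trans hq; apply: ler_wpM2r; first exact: normr_ge0.
  exact: ler_wpM2l.
have := card_sqr_near_int near_int => hcard.
have NE : N%:R <= y ^+ 5 * E.
  by apply: le_trans Ny _; rewrite ler_peMr // ltW.
(* 1436 = 4 (1 + 358); replacing H by y^2 <= 2 H doubles it to 2872, below 2^12. *)
have hK : #|A|%:R * H%:R <= 1436 * (y ^+ 5 * E).
  by move: hcard sum_s NE; rewrite /s; clear; lra.
rewrite -(ler_pM2r (yX 2%N)).
have hK2 := ler_wpM2l (ler0n R #|A|) Hhalf.
apply: le_trans hK2 _.
have -> : 2 ^+ 12 * y ^+ 3 * E * y ^+ 2 = 2 ^+ 12 * (y ^+ 5 * E) by ring.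
have p0 : 0 < y ^+ 5 * E by rewrite mulr_gt0.
by move: hK p0; clear; lra.
Qed.

(** * Counting fractions in a short arc *)

(** Pigeonhole: P + 1 fractional parts fall into P boxes. The common factor of r0 and b0 is removed
    afterwards, which only improves the approximation. *)
Lemma dirichlet_approximation (R : realType) (beta : R) (P : nat) : (0 < P)%N ->
  exists r : nat, exists b : int,
    [/\ (0 < r <= P)%N, coprime `|b| r & `|r%:R * beta - b%:~R| <= 1 / P%:R].
Proof.
move=> P0; have P0' : 0 < P%:R :> R by rewrite ltr0n.
pose fl (j : nat) := Num.floor (j%:R * beta).
pose fr (j : nat) := j%:R * beta - (fl j)%:~R.
have frP j : 0 <= fr j < 1.
  by have := floor_itv (j%:R * beta); rewrite -/(fl j) intrD /fr => /andP[? ?]; apply/andP; lra.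
pose box j := Num.truncn (P%:R * fr j).
have box0 j : 0 <= P%:R * fr j by have /andP[f0 _] := frP j; rewrite mulr_ge0.
have [j [k [ltjk kP eqbox]]] : exists j, exists k, [/\ (j < k)%N, (k <= P)%N & box j = box k].
  apply: contrapT => noeq.
  have : (size (iota 0 P.+1) <= P)%N.
    apply: (@size_le_injective _ _ box) (iota_uniq _ _) _ _ => [j k|j].
      rewrite !mem_iota !add0n !ltnS => /andP[_ jP] /andP[_ kP] eqbox.
      by case: (ltngtP j k) => // lt; exfalso; apply: noeq; [exists j, k|exists k, j].
    move=> _; have /andP[f0 f1] := frP j; rewrite truncn_lt_nat //.
    by rewrite gtr_pMr.
  by rewrite size_iota ltnn.
pose r0 := (k - j)%N; pose b0 : int := fl k - fl j.
have r00 : (0 < r0)%N by rewrite subn_gt0.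
have near : `|r0%:R * beta - b0%:~R| <= 1 / P%:R.
  have -> : r0%:R * beta - b0%:~R = fr k - fr j.
    by rewrite /r0 natrB ?(ltnW ltjk) // /b0 intrB /fr; ring.
  have /andP[j1 j2] := truncn_itv (box0 j); have /andP[k1 k2] := truncn_itv (box0 k).
  rewrite -/(box j) -/(box k) -natr1 eqbox in j1 j2 k1 k2.
  rewrite ler_pdivlMr // -[X in _ * X](gtr0_norm P0') -normrM ler_norml.
  by move: j1 j2 k1 k2; rewrite -eqbox; clear; move=> *; apply/andP; split; lra.
pose g := gcdn r0 `|b0|; have g0 : (0 < g)%N by rewrite gcdn_gt0 r00.
have g0' : 0 < g%:R :> R by rewrite ltr0n.
have gr : (g %| r0)%N by exact: dvdn_gcdl.
have /dvdnP[r rE] := gr.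
have /dvdzP[b bE] : (g%:Z %| b0)%Z by rewrite dvdzE absz_nat dvdn_gcdr.
have bE' : `|b0|%N = (`|b| * g)%N by rewrite bE abszM absz_nat.
exists r, b; split.
- have : (0 < r * g)%N by rewrite -rE.
  rewrite muln_gt0 => /andP[-> _] /=.
  have : (r <= r0)%N by rewrite rE leq_pmulr.
  by move=> h; apply: leq_trans h _; rewrite leq_subLR (leq_trans kP) // leq_addl.
- rewrite /coprime -(eqn_pmul2r g0) mul1n muln_gcdl -bE' -rE gcdnC.
  exact: eqxx.
- apply: le_trans near; rewrite rE bE natrM intrM -pmulrn.
  have -> : r%:R * g%:R * beta - b%:~R * g%:R = g%:R * (r%:R * beta - b%:~R) by ring.
  by rewrite normrM (gtr0_norm g0') ler_peMl // ler1n.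
Qed.

Lemma card_good_moduli (R : realType) (y E beta : R) (n : nat)
    (A : {set 'I_n}) (b : 'I_n -> int) :
  1 <= y -> 1 <= E ->
  (forall k, (0 < k)%N -> k%:R <= 8 * y ^+ 8 -> (size (divisors k))%:R <= E) ->
  (forall k, k%:R <= 8 * y ^+ 8 -> \sum_(1 <= j < k.+1) (j%:R)^-1 <= E) ->
  {in A, forall q : 'I_n, [/\ (0 < q)%N, q%:R <= y ^+ 5, coprime `|b q| q &
     `|(b q)%:~R - q%:R ^+ 2 * beta| <= q%:R ^+ 2 * (8 * y ^+ 12)^-1]} ->
  #|A|%:R <= 2 ^+ 12 * y ^+ 3 * E.
Proof.
move=> y1 E1 tauE harmE AP.
have y0 : 0 < y by lra.
have yX k : 0 < y ^+ k by rewrite exprn_gt0.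
have y81 : 1 <= y ^+ 8 by rewrite exprn_ege1.
pose P := (Num.truncn (y ^+ 8)).+1.
have yP : y ^+ 8 < P%:R by exact: truncnS_gt.
have Py : P%:R <= 2 * y ^+ 8.
  rewrite /P -natr1; have /andP[+ _] := truncn_itv (ltW (yX 8%N)); lra.
have [r [b0 [/andP[r0 rP] cop near]]] := @dirichlet_approximation R beta P isT.
have r0' : 0 < r%:R :> R by rewrite ltr0n.
have P0 : 0 < P%:R :> R by rewrite ltr0n.
have rP' : r%:R <= P%:R :> R by rewrite ler_nat.
set Delta := (8 * y ^+ 12)^-1.
have Delta0 : 0 < Delta by rewrite invr_gt0 mulr_gt0.
have [yr|ry] := leP (y ^+ 4) r%:R.
  apply: (@card_large_denominator R y E beta n r b0 A b) => //.
  - apply: le_trans near _; rewrite !div1r lef_pV2 ?posrE //.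
  - by rewrite yr; apply: le_trans Py.
  (* Since q^2 <= y^10, the error is at most y^10 / (8 y^12) = 1 / (8 y^2), the precision that about
     y^2 frequencies can detect. *)
  move=> q /AP[q0 qy _ hq]; split => //.
  apply: le_trans (ler_wpM2l _ hq) _; first by rewrite mulr_ge0 // ltW.
  have q10 : q%:R ^+ 2 <= y ^+ 10.
    by rewrite (exprM y 5 2) ler_pXn2r ?nnegrE // ltW.
  rewrite mulrA ler_pdivrMr ?mulr_gt0 // mul1r -mulrA ler_pM2l //.
  by rewrite (exprD y 2 10); apply: ler_wpM2l => //; exact: ltW.
have := @card_near_rational R n r b0 beta Delta (y ^+ 5) A b r0 cop Delta0 (ltW (yX 5%N)) AP.
set W := _ + Delta => hA; apply: le_trans hA _.
have rE : (size (divisors r))%:R <= E by apply: tauE => //; lra.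
(* The Dirichlet error gives y^(-8), and r < y^4 gives r Delta <= y^(-8) / 8. *)
have rW : r%:R * W <= 9 / 8 * (y ^+ 8)^-1.
  have h1 : r%:R * `|beta - b0%:~R / r%:R| <= (y ^+ 8)^-1.
    rewrite -{1}(gtr0_norm r0') -normrM mulrBr mulrCA divff ?gt_eqF // mulr1.
    by apply: le_trans near _; rewrite div1r lef_pV2 ?posrE ?ltW.
  have h2 : r%:R * Delta <= (y ^+ 8)^-1 / 8.
    apply: (@le_trans _ _ (y ^+ 4 * Delta)); first by rewrite ler_wpM2r // ltW.
    rewrite /Delta (exprD y 4 8) le_eqVlt; apply/orP; left; apply/eqP.
    by field; rewrite gt_eqF.
  by rewrite /W mulrDr; lra.
have main : 2 * (y ^+ 5) ^+ 2 * r%:R * W + 16 * (y ^+ 5) ^+ 3 * Delta <= 5 * y ^+ 3.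
  have h1 : 2 * (y ^+ 5) ^+ 2 * (r%:R * W) <= 9 / 4 * y ^+ 2.
    have := ler_wpM2l (_ : 0 <= 2 * (y ^+ 5) ^+ 2) rW.
    move=> /(_ ltac:(by rewrite mulr_ge0 // exprn_ge0 // ltW)) h.
    apply: le_trans h _; rewrite le_eqVlt; apply/orP; left; apply/eqP.
    by field; rewrite gt_eqF.
  have h2 : 16 * (y ^+ 5) ^+ 3 * Delta = 2 * y ^+ 3.
    by rewrite /Delta; field; rewrite gt_eqF.
  have h3 : y ^+ 2 <= y ^+ 3 by rewrite ler_weXn2l.
  rewrite h2 -(mulrA _ r%:R); apply: le_trans (lerD h1 (lexx _)) _.
  by move: h3 (yX 3%N); clear; lra.
have W0 : 0 < W by rewrite ltr_wpDl.
apply: le_trans (_ : 1 + E * (5 * y ^+ 3) <= _).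
  rewrite lerD2l; apply: ler_pM rE main => //.
  by apply: addr_ge0; rewrite !mulr_ge0 ?exprn_ge0 // ltW.
have : 1 <= y ^+ 3 * E by rewrite mulr_ege1 // exprn_ege1.
by move: (y ^+ 3) => u; clear; lra.
Qed.

(** * Divisor and harmonic bounds *)

Lemma divisors_primepow_mul (p e m : nat) : prime p -> (0 < m)%N -> coprime p m ->
  (size (divisors (m * p ^ e)) <= e.+1 * size (divisors m))%N.
Proof.
move=> p_pr m0 cop.
have n0 : (0 < m * p ^ e)%N by rewrite muln_gt0 m0 expn_gt0 prime_gt0.
have size_pairs : size [seq (p ^ i * d)%N | i <- iota 0 e.+1, d <- divisors m] =
    (e.+1 * size (divisors m))%N by rewrite size_allpairs size_iota.
rewrite -size_pairs; apply: uniq_leq_size; first exact: divisors_uniq.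
move=> d; rewrite -dvdn_divisors // => dn; have d0 := dvdn_gt0 n0 dn.
have [d' cop' dE] := pfactor_coprime p_pr d0.
apply/allpairsP; exists (logn p d, d'); split; last by rewrite /= {1}dE mulnC.
  rewrite mem_iota add0n ltnS /=; apply: leq_trans (dvdn_leq_log p n0 dn) _.
  have pe0 : (0 < p ^ e)%N by rewrite expn_gt0 prime_gt0.
  by rewrite (lognM p m0 pe0) pfactorK // logn_coprime.
rewrite /= -dvdn_divisors // -(@Gauss_dvdl _ _ (p ^ e)); last first.
  by rewrite coprime_sym coprimeXl.
by apply: dvdn_trans dn; rewrite dE; exact: dvdn_mulr.
Qed.

(** With integer division, e + 1 <= k (e/k + 1) <= k 2^(e/k); then take k-th powers. *)
Lemma exp_succ_le (k e : nat) : (0 < k)%N -> (e.+1 ^ k <= k ^ k * 2 ^ e)%N.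
Proof.
move=> k0; apply: (@leq_trans ((k * 2 ^ (e %/ k)) ^ k)).
  rewrite leq_exp2r //; apply: (@leq_trans (k * (e %/ k).+1)).
    by rewrite mulnC; exact: ltn_ceil.
  by rewrite leq_mul2l ltn_expl // orbT.
rewrite expnMn leq_mul2l; apply/orP; right.
by rewrite -expnM leq_exp2l // leq_divM.
Qed.

(* Strip one prime power p^e at a time: (e+1)^k <= p^e when p >= 2^k, and the at most
   2^k smaller primes cost a factor k^k each. *)
Lemma size_divisors_exp_le (k : nat) : (0 < k)%N ->
  exists C : nat, forall n, (0 < n)%N -> (size (divisors n) ^ k <= C * n)%N.
Proof.
move=> k0; pose small n := [seq p <- primes n | (p < 2 ^ k)%N].
have kk0 : (0 < k ^ k)%N by rewrite expn_gt0 k0.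
suff main n : (0 < n)%N -> (size (divisors n) ^ k <= (k ^ k) ^ size (small n) * n)%N.
  exists ((k ^ k) ^ (2 ^ k))%N => n n0; apply: leq_trans (main n n0) _.
  rewrite leq_mul2r leq_pexp2l ?orbT // -(size_iota 0 (2 ^ k)).
  apply: uniq_leq_size; first by rewrite filter_uniq // primes_uniq.
  by move=> p; rewrite mem_filter mem_iota => /andP[].
have [N] := ubnP n; elim: N n => // N IHN n ltnN n0.
have [n1|n1] := leqP n 1.
  have -> : n = 1%N by lia.
  by rewrite /small /= exp1n.
have p_pr := pdiv_prime n1; set p := pdiv n in p_pr.
have [m cop nE] := pfactor_coprime p_pr n0; set e := logn p n in nE.
have e0 : (0 < e)%N by rewrite logn_gt0 mem_primes p_pr n0 pdiv_dvd.
have m0 : (0 < m)%N by move: n0; rewrite nE muln_gt0 => /andP[].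
have pe1 : (1 < p ^ e)%N by rewrite -(exp1n e) ltn_exp2r ?prime_gt1.
have mn : (m < n)%N by rewrite nE ltn_Pmulr.
have IHm := IHN m (leq_trans mn ltnN) m0.
have pm : p \notin primes m.
  by rewrite mem_primes p_pr m0 /= -prime_coprime.
have sub_primes : {subset primes m <= primes n}.
  by move=> q; rewrite !mem_primes m0 n0 nE /= => /andP[-> qm]; rewrite dvdn_mulr.
have pn : p \in primes n by rewrite mem_primes p_pr n0 pdiv_dvd.
have small_le : (size (small m) + (p < 2 ^ k) <= size (small n))%N.
  have u : uniq (small m) by rewrite filter_uniq // primes_uniq.
  case: ltnP => pk; rewrite ?addn0 ?addn1.
    apply: (@uniq_leq_size _ (p :: small m)).
      by rewrite /= u mem_filter (negbTE pm) andbF.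
    move=> q; rewrite inE !mem_filter => /orP[/eqP ->|/andP[-> /sub_primes ->]] //.
    by rewrite pk.
  apply: uniq_leq_size => // q; rewrite !mem_filter => /andP[-> /sub_primes ->] //.
apply: (@leq_trans (e.+1 ^ k * size (divisors m) ^ k)).
  by rewrite -expnMn leq_exp2r // {1}nE divisors_primepow_mul.
apply: (@leq_trans ((k ^ k) ^ (p < 2 ^ k)%N * p ^ e * ((k ^ k) ^ size (small m) * m))).
  apply: leq_mul => //; case: ltnP => pk.
    rewrite expn1; apply: leq_trans (exp_succ_le e k0) _.
    by rewrite leq_mul2l leq_exp2r ?prime_gt1 ?orbT.
  rewrite expn0 mul1n; apply: (@leq_trans ((2 ^ e) ^ k)).
    by rewrite leq_exp2r // ltn_expl.
  by rewrite -expnM mulnC expnM leq_exp2r.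
rewrite mulnACA [X in (_ <= _ * X)%N]nE [(m * _)%N]mulnC leq_mul2r -expnD addnC.
by rewrite leq_pexp2l ?orbT.
Qed.

Lemma size_divisors_le_powR (R : realType) (kappa : R) : 0 < kappa ->
  exists2 C : R, 1 <= C & forall n, (0 < n)%N ->
    (size (divisors n))%:R <= C * n%:R `^ kappa.
Proof.
move=> kappa0; pose k := (Num.truncn kappa^-1).+1.
have [C0 C0P] := size_divisors_exp_le (isT : (0 < k)%N).
have k0 : 0 < k%:R :> R by rewrite ltr0n.
(* The successor ensures C >= 1, so that the k-th root of C is at most C. *)
pose C : R := C0.+1%:R; have C1 : 1 <= C by rewrite ler1n.
have C_ge0 : 0 <= C by lra.
exists C => // n n0; have n1 : 1 <= n%:R :> R by rewrite ler1n.
have k_kappa : k%:R^-1 <= kappa.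
  by rewrite invf_ple ?posrE // ltW // truncnS_gt.
set t := (size _)%:R; have t0 : 0 <= t by rewrite ler0n.
have -> : t = (t ^+ k) `^ k%:R^-1.
  by rewrite -powR_mulrn // -powRrM mulfV ?gt_eqF // powRr1.
have tC : t ^+ k <= C * n%:R.
  rewrite /t /C -natrX -natrM ler_nat; apply: leq_trans (C0P n n0) _.
  by rewrite leq_mul2r leqnSn orbT.
apply: le_trans (ge0_ler_powR _ _ _ tC) _; rewrite ?nnegrE ?invr_ge0 ?exprn_ge0 ?mulr_ge0 //.
rewrite powRM //; apply: ler_pM; rewrite ?powR_ge0 //; last exact: ler_powR.
by apply: ler1_powR => //; rewrite invf_le1 // ler1n.
Qed.

(** The sum is at most 1 + ln n, and kappa ln n = ln (n^kappa) <= n^kappa. *)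
Lemma harmonic_le_powR (R : realType) (kappa : R) (n : nat) : 0 < kappa ->
  \sum_(1 <= j < n.+1) (j%:R)^-1 <= 1 + kappa^-1 * n%:R `^ kappa.
Proof.
move=> kappa0; have [->|n0] := posnP n.
  by rewrite big_geq // addr_ge0 ?mulr_ge0 ?powR_ge0 // invr_ge0 ltW.
have le_ln : forall m, \sum_(1 <= j < m.+2) (j%:R)^-1 <= 1 + ln m.+1%:R :> R.
  elim=> [|m IHm]; first by rewrite big_nat1 invr1 ln1 addr0.
  rewrite big_nat_recr //=; apply: le_trans (lerD IHm (lexx _)) _.
  rewrite -addrA lerD2l.
  have m1 : 0 < m.+1%:R :> R by rewrite ltr0n.
  have m2 : 0 < m.+2%:R :> R by rewrite ltr0n.
  have lt1 : m.+2%:R^-1 < 1 :> R by rewrite invf_lt1 // ltr1n.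
  have -> : m.+1%:R = m.+2%:R * (1 + - m.+2%:R^-1) :> R.
    by rewrite mulrDr mulr1 mulrN divff ?gt_eqF // -[in RHS]natr1 addrK.
  rewrite lnM ?posrE //; last by rewrite subr_gt0.
  have := @le_ln1Dx R (- m.+2%:R^-1); rewrite ltrN2 => /(_ lt1).
  by move: (m.+2%:R^-1) => u; move: (ln (1 - u)) (ln _) => v w; clear; lra.
have n1 : 0 < n%:R :> R by rewrite ltr0n.
apply: le_trans (_ : 1 + ln n%:R <= _); first by have := le_ln n.-1; rewrite prednK.
rewrite lerD2l -ler_pdivrMl ?invr_gt0 // invrK -ln_powR.
have p0 : 0 < n%:R `^ kappa by rewrite powR_gt0.
have h := @le_ln1Dx R (n%:R `^ kappa - 1); rewrite addrCA subrr addr0 in h.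
by apply: le_trans (h _) _; lra.
Qed.

(** * The sieve for square moduli *)

(** Numerators run from 1 to q^2, so classes are represented in (0, n], with n standing for 0. *)
Lemma eq_of_eqmod_le (a a' n : nat) :
  (0 < a <= n)%N -> (0 < a' <= n)%N -> (a = a' %[mod n])%N -> a = a'.
Proof.
wlog le_a : a a' / (a <= a')%N.
  by move=> wl an a'n eqa; case: (leqP a a') => [|/ltnW] le_a; [|apply: esym];
    apply: wl.
move=> /andP[a0 an] /andP[a'0 a'n] /eqP; rewrite eq_sym eqn_mod_dvd // => dvd_n.
apply/eqP; rewrite eqn_leq le_a -subn_eq0 /=; apply/negPn/negP; rewrite -lt0n => lt0.
by have := dvdn_leq lt0 dvd_n; lia.
Qed.

Lemma square_sieve_sumE (R : realType) (c : nat -> R[i]) (Q N : R) :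
  square_sieve_sum c Q N =
  \sum_(j <- [seq (q, a) | q <- index_iota 1 (Num.truncn Q).+1,
                a <- [seq a <- index_iota 1 (q ^ 2).+1 | coprime a q]])
     normc (expsum c N (j.2%:R / (j.1 ^ 2)%:R)) ^+ 2.
Proof.
rewrite big_allpairs_dep /=; apply: eq_bigr => q _.
by rewrite big_filter.
Qed.

(* An arc of length 1/(4N) contains at most one fraction a/q^2 for each q. *)
Lemma square_sieve_small_Q (R : realType) (y E N : R) (c : nat -> R[i]) :
  1 <= y -> 1 <= E -> y ^+ 12 <= N ->
  (forall k, (0 < k)%N -> k%:R <= 8 * y ^+ 8 -> (size (divisors k))%:R <= E) ->
  (forall k, k%:R <= 8 * y ^+ 8 -> \sum_(1 <= j < k.+1) (j%:R)^-1 <= E) ->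
  square_sieve_sum c (y ^+ 5) N <= 12 ^+ 2 * (2 ^+ 12 * y ^+ 3 * E) * N * sqnorm c N.
Proof.
move=> y1 E1 yN tauE harmE.
have y0 : 0 < y by lra.
have yX k : 0 < y ^+ k by rewrite exprn_gt0.
have N1 : 1 <= N by apply: le_trans yN; rewrite exprn_ege1.
have N0 : 0 < N by lra.
rewrite square_sieve_sumE; set s := (X in \sum_(j <- X) _).
pose x (j : nat * nat) : R := j.2%:R / (j.1 ^ 2)%:R.
have sP j : j \in s -> [/\ (0 < j.1)%N, (j.1 <= Num.truncn (y ^+ 5))%N, (0 < j.2 <= j.1 ^ 2)%N
    & coprime j.2 j.1].
  case/allpairsPdep => q [a]; rewrite mem_filter !mem_index_iota.
  by move=> [/andP[q0 qQ] /andP[cop aq] ->].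
have us : uniq s.
  apply: allpairs_uniq_dep => [|q _|[q a] [q' a'] _ _ /= [-> ->]] //.
    exact: iota_uniq.
  by rewrite filter_uniq ?iota_uniq.
set K0 := 2 ^+ 12 * y ^+ 3 * E.
have K00 : 0 <= K0 by rewrite !mulr_ge0 ?exprn_ge0 //; lra.
have /andP[K0le _] := truncn_itv K00; set K := Num.truncn K0 in K0le.
have Z0 : 0 <= sqnorm c N by apply: sumr_ge0 => n _; rewrite exprn_ge0 ?normc_ge0.
apply: (@le_trans _ _ (12 ^+ 2 * K%:R * N * sqnorm c N)); last first.
  apply: ler_wpM2r => //; apply: ler_wpM2r; first exact: ltW.
  by apply: ler_wpM2l; rewrite // exprn_ge0.
apply: (large_sieve (x := x) c N1) => i t si.
rewrite -size_filter; set s' := seq.filter _ s.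
(* [beta] is the centre of the arc, and num j / q^2 is the lift of x j to the real line that lies
   within 1/(8N) of it. *)
pose beta := x i - t - (8 * N)^-1.
pose k (j : nat * nat) := Num.floor (x i - x j + 1 / 2).
pose num (j : nat * nat) : int := j.2%:Z + k j * (j.1 ^ 2)%N%:Z.
have num_near j : j \in s' ->
    `|(num j)%:~R - j.1%:R ^+ 2 * beta| <= j.1%:R ^+ 2 * (8 * N)^-1.
  rewrite mem_filter => /andP[/andP[t1 t2] sj]; have [q0 _ _ _] := sP j sj.
  have q0' : 0 < j.1%:R ^+ 2 :> R by rewrite exprn_gt0 // ltr0n.
  rewrite /num intrD intrM -!pmulrn natrX.
  have -> : j.2%:R + (k j)%:~R * j.1%:R ^+ 2 - j.1%:R ^+ 2 * beta =
      j.1%:R ^+ 2 * ((8 * N)^-1 - (centered_frac (x i - x j) - t)).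
    have xjE : x j = j.2%:R / j.1%:R ^+ 2 by rewrite /x natrX.
    rewrite /centered_frac -/(k j) /beta xjE; move: q0'; clear.
    move: (x i) ((8 * N)^-1) (j.1%:R ^+ 2) (j.2%:R) ((k j)%:~R) => u v w a z w0.
    by field; rewrite gt_eqF.
  rewrite normrM (gtr0_norm q0') ler_pM2l //.
  have N4 : (4 * N)^-1 = 2 * (8 * N)^-1 by field; rewrite gt_eqF.
  rewrite N4 in t2; rewrite ler_norml.
  by move: t1 t2; move: ((8 * N)^-1) (centered_frac _) => u v; clear;
    move=> t1 t2; apply/andP; split; lra.
have num_inj j j' : j \in s' -> j' \in s' -> j.1 = j'.1 -> j = j'.
  move=> s'j s'j' eq1; have := num_near j s'j; have := num_near j' s'j'; rewrite -eq1.
  move: s'j s'j'; rewrite !mem_filter => /andP[_ /sP[q0 qQ aq _]] /andP[_ /sP[_ _ aq' _]].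
  set q := j.1 in q0 qQ aq eq1 *; rewrite -eq1 in aq'.
  have q5 : q%:R <= y ^+ 5 by rewrite -truncn_ge_nat // ltW.
  (* As q^2 <= y^10 <= N, two numerators for the same q differ by at most 1/4 and hence agree. *)
  have small : q%:R ^+ 2 * (8 * N)^-1 <= 1 / 8.
    rewrite ler_pdivrMr ?mulr_gt0 //.
    have h1 : q%:R ^+ 2 <= (y ^+ 5) ^+ 2 by rewrite ler_pXn2r ?nnegrE // ltW.
    have h2 : (y ^+ 5) ^+ 2 <= y ^+ 12 by rewrite -exprM ler_weXn2l.
    by lra.
  rewrite !ler_norml => /andP[n1 n2] /andP[n3 n4].
  have num_eq : num j = num j'.
    apply/eqP; rewrite -subr_eq0 -normr_le0 -ltzD1 add0r -(ltr_int R) intr_norm intrB.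
    by rewrite ltr_norml; apply/andP; split; lra.
  have eq_mod : (j.2 = j'.2 %[mod q ^ 2])%N.
    have h : (j.2%:Z = j'.2%:Z + (k j' - k j) * (q ^ 2)%N%:Z)%R.
      by move: num_eq; rewrite /num -eq1 -/q; move: (j.2%:Z) (j'.2%:Z) (k j) (k j') (_%:Z);
        clear; move=> *; lra.
    have : (j.2%:Z %% (q ^ 2)%N)%Z = (j'.2%:Z %% (q ^ 2)%N)%Z.
      by rewrite h addrC modzMDl.
    by rewrite !modz_nat => -[].
  rewrite (surjective_pairing j) (surjective_pairing j') -eq1.
  by rewrite (eq_of_eqmod_le aq aq' eq_mod).
pose n := (Num.truncn (y ^+ 5)).+1.
pose A := [set q : 'I_n | (q : nat) \in map fst s'].
have s's j : j \in s' -> j \in s by rewrite mem_filter => /andP[].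
have size_le : (size s' <= #|A|)%N.
  rewrite -(size_map fst) cardE -(size_map val); apply: uniq_leq_size.
    by rewrite map_inj_in_uniq ?filter_uniq.
  move=> q qs'; have [j s'j qE] := mapP qs'.
  have qn : (q < n)%N by rewrite ltnS qE; have [] := sP j (s's j s'j).
  by apply/mapP; exists (Ordinal qn); rewrite ?mem_enum ?inE.
(* A total choice of numerators indexed by q; outside A the value 0 is a dummy. *)
have ex_num (q : 'I_n) : exists z : int, q \in A ->
    exists2 j, j \in s' & (q : nat) = j.1 /\ z = num j.
  case qA: (q \in A); last by exists 0.
  by move: qA; rewrite inE => /mapP[j s'j qE]; exists (num j) => _; exists j.
have [b bP] := boolp.choice ex_num.
apply: leq_trans size_le _; rewrite truncn_ge_nat //.
apply: (@card_good_moduli R y E beta n A b) => // q /bP[j s'j [-> ->]].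
have [q0 qQ _ cop] := sP j (s's j s'j); split => //.
- by rewrite -truncn_ge_nat // ltW.
- have : coprimez j.1%:Z (num j).
    rewrite /coprimez /num addrC -mulnn PoszM mulrA gcdzMDl.
    by rewrite -/(coprimez _ _) coprimezE !absz_nat coprime_sym.
  by rewrite coprimezE absz_nat coprime_sym.
- apply: le_trans (num_near j s'j) _; apply: ler_wpM2l; first exact: exprn_ge0.
  by rewrite lef_pV2 ?posrE ?mulr_gt0 // ler_pM2l.
Qed.

Lemma square_sieve_case1 (R : realType) (eps : R) : 0 < eps ->
  exists2 C : R, 0 < C &
    forall (Q N : R) (c : nat -> R[i]), 1 <= Q -> 1 <= N -> Q <= N `^ (5 / 12) ->
      square_sieve_sum c Q N <= C * Q `^ (3 / 5 + eps) * N * sqnorm c N.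
Proof.
(* E grows like (y^8)^kappa = Q^(8 kappa / 5), so this kappa produces exactly Q^eps. *)
move=> eps0; pose kappa := 5 * eps / 8; have kappa0 : 0 < kappa by rewrite /kappa; lra.
have [C1 C1_ge1 C1P] := size_divisors_le_powR kappa0.
have ikappa0 : 0 < kappa^-1 by rewrite invr_gt0.
pose C2 := C1 + 1 + kappa^-1; have C2_ge1 : 1 <= C2 by rewrite /C2; lra.
exists (12 ^+ 2 * 2 ^+ 12 * (C2 * 8 `^ kappa)).
  by apply: mulr_gt0; [rewrite mulr_gt0 ?exprn_gt0|rewrite mulr_gt0 ?powR_gt0 //; lra].
move=> Q N c Q1 N1 QN; have Q0 : 0 < Q by lra.
have Qpow (u v : R) : Q `^ (u + v) = Q `^ u * Q `^ v.
  by rewrite powRD // (gt_eqF Q0) implybT.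
pose y := Q `^ (1 / 5).
have y1 : 1 <= y.
  by rewrite -[leLHS](powRr0 Q); apply: ler_powR => //; lra.
have y0 : 0 < y by lra.
have yX k : y ^+ k = Q `^ (k%:R / 5).
  by rewrite -powR_mulrn ?ltW // /y -powRrM; congr (_ `^ _); lra.
have y5 : y ^+ 5 = Q by rewrite yX divff // powRr1 // ltW.
have yN : y ^+ 12 <= N.
  have -> : N = (N `^ (5 / 12)) `^ (12 / 5).
    by rewrite -powRrM (_ : 5 / 12 * (12 / 5) = 1) ?powRr1 //; [lra|field].
  by rewrite yX; apply: ge0_ler_powR; rewrite ?nnegrE ?powR_ge0 //; lra.
pose E := C2 * (8 * y ^+ 8) `^ kappa.
have y8 : 1 <= y ^+ 8 by rewrite exprn_ege1.
have base1 : 1 <= (8 * y ^+ 8) `^ kappa.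
  by rewrite -[leLHS](powRr0 (8 * y ^+ 8)); apply: ler_powR; [lra|exact: ltW].
have E1 : 1 <= E by rewrite /E mulr_ege1.
have le_base k : k%:R <= 8 * y ^+ 8 -> k%:R `^ kappa <= (8 * y ^+ 8) `^ kappa.
  by move=> hk; apply: ge0_ler_powR; rewrite ?nnegrE // ?(ltW kappa0) //; lra.
have tauE k : (0 < k)%N -> k%:R <= 8 * y ^+ 8 -> (size (divisors k))%:R <= E.
  move=> k0 hk; apply: le_trans (C1P k k0) _; apply: ler_pM; rewrite ?powR_ge0 ?le_base //.
    lra.
  by rewrite /C2; lra.
have harmE k : k%:R <= 8 * y ^+ 8 -> \sum_(1 <= j < k.+1) (j%:R)^-1 <= E.
  move=> hk; apply: le_trans (harmonic_le_powR k kappa0) _.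
  have h := ler_wpM2l (ltW ikappa0) (le_base k hk).
  have h2 := ler_wpM2r (le_trans ler01 base1) C1_ge1.
  by rewrite /E /C2; move: h h2 base1; clear; lra.
have := square_sieve_small_Q c y1 E1 yN tauE harmE; rewrite y5.
move=> h; apply: le_trans h _; rewrite le_eqVlt; apply/orP; left; apply/eqP.
have -> : Q `^ (3 / 5 + eps) = y ^+ 3 * (y ^+ 8) `^ kappa.
  rewrite Qpow -yX (yX 8%N) -powRrM; congr (_ * _ `^ _).
  by rewrite /kappa; field.
rewrite /E powRM ?exprn_ge0 ?(ltW y0) //; move: (2 ^+ 12) (12 ^+ 2) => u v.
ring.
Qed.

Lemma expsum_truncate (R : realType) (c : nat -> R[i]) (N N' alpha : R) :
  N <= N' ->
  expsum (fun n => if (n <= Num.truncn N)%N then c n else 0) N' alpha =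
  expsum c N alpha.
Proof.
move=> NN'; have le_t := le_truncn NN'.
rewrite /expsum (big_cat_nat (n := (Num.truncn N).+1)) //= [X in _ + X]big_nat_cond.
rewrite [X in _ + X]big1 ?addr0; last first.
  by move=> n /andP[/andP[lt_n _] _]; rewrite leqNgt lt_n mul0r.
by apply: eq_big_nat => n /andP[_]; rewrite ltnS => ->.
Qed.

Lemma sqnorm_truncate (R : realType) (c : nat -> R[i]) (N N' : R) : N <= N' ->
  sqnorm (fun n => if (n <= Num.truncn N)%N then c n else 0) N' = sqnorm c N.
Proof.
move=> NN'; have le_t := le_truncn NN'.
rewrite /sqnorm (big_cat_nat (n := (Num.truncn N).+1)) //= [X in _ + X]big_nat_cond.
rewrite [X in _ + X]big1 ?addr0; last first.
  by move=> n /andP[/andP[lt_n _] _]; rewrite leqNgt lt_n normc0 expr0n.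
by apply: eq_big_nat => n /andP[_]; rewrite ltnS => ->.
Qed.

Theorem theorem4 (R : realType) (eps : R) (heps : 0 < eps) :
  exists2 C : R, 0 < C &
    forall (Q N : R) (c : nat -> R[i]), 1 <= Q -> 1 <= N ->
      (Q <= N `^ (5 / 12) ->
        square_sieve_sum c Q N <= C * Q `^ (3 / 5 + eps) * N * sqnorm c N) /\
      (N `^ (5 / 12) < Q ->
        square_sieve_sum c Q N <= C * Q `^ (3 + eps) * sqnorm c N).
Proof.
have [C C0 case1] := square_sieve_case1 heps.
exists C => // Q N c Q1 N1; split; first exact: case1.
(* For this N' the first range holds with equality, and the factor N' turns Q^(3/5) into Q^3. *)
move=> QN; pose N' := Q `^ (12 / 5); have Q0 : 0 <= Q by lra.
have Q_gt0 : 0 < Q by lra.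
have N'Q : N' `^ (5 / 12) = Q.
  by rewrite /N' -powRrM (_ : 12 / 5 * (5 / 12) = 1) ?powRr1 //; field.
have N'1 : 1 <= N' by rewrite -[leLHS](powRr0 Q); apply: ler_powR => //; lra.
have NN' : N <= N'.
  have -> : N = (N `^ (5 / 12)) `^ (12 / 5).
    by rewrite -powRrM (_ : 5 / 12 * (12 / 5) = 1) ?powRr1 //; [lra|field].
  by apply: ge0_ler_powR; rewrite ?nnegrE ?powR_ge0 //; lra.
have := case1 Q N' (fun n => if (n <= Num.truncn N)%N then c n else 0) Q1 N'1.
rewrite N'Q => /(_ (lexx _)).
rewrite sqnorm_truncate // -(mulrA C) /N' -powRD; last by rewrite (gt_eqF Q_gt0) implybT.
rewrite (_ : 3 / 5 + eps + 12 / 5 = 3 + eps); last by field.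
move=> h; apply: le_trans h; rewrite le_eqVlt; apply/orP; left; apply/eqP.
by apply: eq_bigr => q _; apply: eq_bigr => a _; rewrite expsum_truncate.
Qed.
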